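(* There exist absolute constants $C, c, c' > 0$ (not depending on $d$, $p$, $\boldsymbol{w}$, $\boldsymbol{b}$, $\boldsymbol{x}$ or $\varepsilon$) such that the following holds. Let $d \geq 1$, $p \in [1,\infty]$, and let $p' \in [1,\infty]$ satisfy $\frac{1}{p} + \frac{1}{p'} = 1$. Let $f(\boldsymbol{z}) = \boldsymbol{w}^T \boldsymbol{z} + \boldsymbol{b}$ be a binary linear classifier on $\mathbb{R}^d$ with $\boldsymbol{w} \in \mathbb{R}^d \setminus \{\boldsymbol{0}\}$, $\boldsymbol{b} \in \mathbb{R}$, and let $\boldsymbol{x} \in \mathbb{R}^d$ with $f(\boldsymbol{x}) \neq 0$. Then for every $0 < \varepsilon < \frac{c^2}{c'}$, \[ C\sqrt{\varepsilon}\, d^{1/p} \frac{\|\boldsymbol{w}\|_{p'}}{\|\boldsymbol{w}\|_2} \leq \frac{r_{p,\varepsilon}(\boldsymbol{x})}{\|\boldsymbol{r}^*_p(\boldsymbol{x})\|_p} \leq \frac{1}{\sqrt{c - \sqrt{c'\varepsilon}}}\, d^{1/p} \frac{\|\boldsymbol{w}\|_{p'}}{\|\boldsymbol{w}\|_2}. \]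
   Context: For the binary linear classifier $f(\boldsymbol{z}) = \boldsymbol{w}^T\boldsymbol{z} + \boldsymbol{b}$, the predicted label is $g(\boldsymbol{z}) = 1$ if $f(\boldsymbol{z}) > 0$ and $g(\boldsymbol{z}) = 0$ otherwise. For $p \in [1,\infty]$, $\mathcal{B}_p = \{\boldsymbol{z} \in \mathbb{R}^d : \|\boldsymbol{z}\|_p \leq 1\}$ is the unit $\ell_p$ ball, and $\boldsymbol{v}$ denotes a random vector uniformly distributed (w.r.t. Lebesgue measure) on $\mathcal{B}_p$. For $\varepsilon > 0$, $r_{p,\varepsilon}(\boldsymbol{x}) = \inf\{|\alpha| : \alpha \in \mathbb{R},\ \mathbb{P}_{\boldsymbol{v}}\{g(\boldsymbol{x} + \alpha\boldsymbol{v}) \neq g(\boldsymbol{x})\} \geq \varepsilon\}$, with the convention $\inf\emptyset = +\infty$. Also $\|\boldsymbol{r}^*_p(\boldsymbol{x})\|_p = \inf\{\|\boldsymbol{r}\|_p : g(\boldsymbol{x}+\boldsymbol{r}) \neq g(\boldsymbol{x})\}$, the $\ell_p$-distance from $\boldsymbol{x}$ to the decision boundary. Here $d^{1/\infty} = 1$. *)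

(* Defs.v *)
From HB Require Import structures.
From mathcomp Require Import all_boot all_order all_algebra.
From mathcomp Require Import all_classical all_reals all_analysis.
Set Implicit Arguments. Unset Strict Implicit. Unset Printing Implicit Defensive.
Import Order.TTheory GRing.Theory Num.Theory.
Local Open Scope classical_set_scope.
Local Open Scope ring_scope.

Section Defs.
Variable R : realType.

Definition lpnorm (d : nat) (p : \bar R) (z : 'rV[R]_d) : R :=
  match p with
  | r%:E => (\sum_(i < d) `|z 0 i| `^ r) `^ (r^-1)
  | _ => \big[Num.max/0]_(i < d) `|z 0 i|
  end.

Definition inv_exp (p : \bar R) : R :=
  match p with r%:E => r^-1 | _ => 0 end.

Definition linf (d : nat) (w : 'rV[R]_d) (b : R) (z : 'rV[R]_d) : R :=
  \sum_(i < d) w 0 i * z 0 i + b.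

Definition glab (d : nat) (w : 'rV[R]_d) (b : R) (z : 'rV[R]_d) : bool :=
  0 < linf w b z.

Definition lpball (d : nat) (p : \bar R) : set 'rV[R]_d :=
  [set z | lpnorm p z <= 1].

Definition box (d : nat) (a b : 'rV[R]_d) : set 'rV[R]_d :=
  [set z | forall i, a 0 i <= z 0 i < b 0 i].

Definition boxvol (d : nat) (a b : 'rV[R]_d) : R :=
  \prod_(i < d) Num.max 0 (b 0 i - a 0 i).

Definition leb_outer (d : nat) (A : set 'rV[R]_d) : \bar R :=
  ereal_inf [set (\sum_(0 <= k <oo) (boxvol (ab.1 k) (ab.2 k))%:E)%E
            | ab in [set ab : (nat -> 'rV[R]_d) * (nat -> 'rV[R]_d) |
                     A `<=` \bigcup_k box (ab.1 k) (ab.2 k)]].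

(* probability, for v uniform on the unit l_p ball, that g(x + alpha v) <> g(x) *)
Definition flip_prob (d : nat) (p : \bar R) (w : 'rV[R]_d) (b : R)
    (x : 'rV[R]_d) (alpha : R) : R :=
  fine (leb_outer (lpball p `&` [set v | glab w b (x + alpha *: v) != glab w b x]))
  / fine (leb_outer (lpball (d := d) p)).

(* r_{p,eps}(x), with inf of the empty set = +oo *)
Definition r_peps (d : nat) (p : \bar R) (w : 'rV[R]_d) (b : R)
    (x : 'rV[R]_d) (eps : R) : \bar R :=
  ereal_inf [set (`|alpha|)%:E | alpha in [set alpha | eps <= flip_prob p w b x alpha]].

Definition rstar_norm (d : nat) (p : \bar R) (w : 'rV[R]_d) (b : R)
    (x : 'rV[R]_d) : R :=
  inf [set lpnorm p r | r in [set r | glab w b (x + r) != glab w b x]].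

End Defs.

(* Main.v *)
(* The flip probability of [x + alpha v] is governed by the tail of the linear
   form [w.v], so the theorem amounts to two bounds for [v] uniform on the
   l_p ball: a Chebyshev bound P(|w.v| >= t) <= A d^(-2/p) |w|_2^2 / t^2 and an
   anticoncentration bound P(w.v > s d^(-1/p) |w|_2) >= eps0.  Both follow from
   E (w.v)^2 and E (w.v)^4 once the coordinates satisfy
   E v_j^2 >= a d^(-2/p) and E v_j^4 <= A d^(-4/p), since reflections kill the
   odd mixed moments.

   These coordinate moments need neither Fubini nor Gamma functions: the part of
   the ball where [|v_j|] is large (or small) is contained in the image of the
   ball under a diagonal matrix, and the determinant of that matrix bounds its
   probability, which gives P(|v_j| >= u d^(-1/p)) <= 2 exp(-(u - 1)/2) and
   P(|v_j| <= s d^(-1/p)) <= e s.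

   The distance to the boundary is |f(x)| / |w|_p' by Hoelder's inequality and
   its equality case. *)
Require Import Defs.
From HB Require Import structures.
From mathcomp Require Import all_boot all_order all_algebra.
From mathcomp Require Import all_classical all_reals all_analysis.
From mathcomp Require Import measurable_realfun ring lra.
Set Implicit Arguments. Unset Strict Implicit. Unset Printing Implicit Defensive.
Import Order.TTheory GRing.Theory Num.Theory numFieldNormedType.Exports.
Local Open Scope classical_set_scope.
Local Open Scope ring_scope.

(** * The outer measure [leb_outer] *)

Lemma boxvol_ge0 (R : realType) d (a b : 'rV[R]_d) : 0 <= boxvol a b.
Proof. by apply: prodr_ge0 => i _; rewrite le_max lexx. Qed.

Lemma leb_outer_le_cover (R : realType) d (A : set 'rV[R]_d)
    (a b : nat -> 'rV[R]_d) : A `<=` \bigcup_k box (a k) (b k) ->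
  (leb_outer A <= \sum_(0 <= k <oo) (boxvol (a k) (b k))%:E)%E.
Proof. by move=> Aab; apply: ereal_inf_lbound; exists (a, b). Qed.

Lemma leb_outer_glb (R : realType) d (A : set 'rV[R]_d) (x : \bar R) :
  (forall a b : nat -> 'rV[R]_d, A `<=` \bigcup_k box (a k) (b k) ->
    (x <= \sum_(0 <= k <oo) (boxvol (a k) (b k))%:E)%E) -> (x <= leb_outer A)%E.
Proof.
by move=> H; apply: le_ereal_inf_tmp => _ [[a b] /= Aab <-]; exact: H.
Qed.

Lemma leb_outer_ge0 (R : realType) d (A : set 'rV[R]_d) : (0 <= leb_outer A)%E.
Proof.
apply: leb_outer_glb => a b _; apply: nneseries_ge0 => k _ _.
by rewrite lee_fin boxvol_ge0.
Qed.

(** The dimension is positive because in dimension 0 every box has volume 1, the empty product, and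
    every countable cover then costs [+oo]. *)
Lemma leb_outer_set0 (R : realType) d : leb_outer (set0 : set 'rV[R]_d.+1) = 0%E.
Proof.
apply/eqP; rewrite eq_le leb_outer_ge0 andbT.
apply: (le_trans (@leb_outer_le_cover _ _ _ (fun=> 0) (fun=> 0) (sub0set _))).
rewrite eseries0// => k _ _; rewrite /boxvol big_ord_recl subrr maxxx.
by rewrite mul0r.
Qed.

Lemma le_leb_outer (R : realType) d :
  {homo @leb_outer R d : A B / A `<=` B >-> (A <= B)%E}.
Proof.
move=> A B AB; apply: leb_outer_glb => a b Bab.
by apply: leb_outer_le_cover; exact: subset_trans Bab.
Qed.

(** Covers of the [A n] that are optimal up to [e / 2 ^ n.+1] are merged into a single sequence
    through a bijection between [nat] and [nat * nat]. *)
Lemma leb_outer_sigma_subadditive (R : realType) d :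
  sigma_subadditive (@leb_outer R d).
Proof.
move=> A; have [[i ioo]|] := pselect (exists i, leb_outer (A i) = +oo%E).
  rewrite (eseries_pinfty _ _ ioo) ?leey// => n _.
  by rewrite -ltNye (lt_le_trans _ (leb_outer_ge0 _)).
rewrite -forallNE => Aoo.
apply/lee_addgt0Pr => e e0.
rewrite (le_trans _ (epsilon_trick _ _ (ltW e0)))//; last first.
  by move=> n; exact: leb_outer_ge0.
pose P n (B : nat -> 'rV[R]_d * 'rV[R]_d) :=
  A n `<=` \bigcup_k box (B k).1 (B k).2 /\
  (\sum_(k <oo) (boxvol (B k).1 (B k).2)%:E
     <= leb_outer (A n) + (e / (2 ^ n.+1)%:R)%:E)%E.
have [G PG] : {G & forall n, P n (G n)}.
  apply: (@choice _ _ P) => n; rewrite /P.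
  have en : 0 < e / (2 ^ n.+1)%:R by rewrite divr_gt0// ltr0n expn_gt0.
  have fA : leb_outer (A n) \is a fin_num.
    by rewrite ge0_fin_numE ?leb_outer_ge0// ltey; apply/eqP/Aoo.
  have [_ [[a b] /= Aab <-] lt] := lb_ereal_inf_adherent en fA.
  by exists (fun k => (a k, b k)); split => //; exact: ltW.
pose v (x : nat * nat) := (boxvol (G x.1 x.2).1 (G x.1 x.2).2)%:E.
have v0 x : (0 <= v x)%E by rewrite lee_fin boxvol_ge0.
apply: (@le_trans _ _ (\sum_(i <oo) \sum_(j <oo) v (i, j))%E); last first.
  apply: lee_nneseries => [i _ _|i _]; first exact: nneseries_ge0.
  exact: (PG i).2.
have /card_esym/ppcard_eqP[f] := card_nat2.
rewrite nneseries_esumT; last first.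
  by move=> i; apply: nneseries_ge0 => j _ _; exact: v0.
under eq_esum => i _ do rewrite nneseries_esumT//.
rewrite esum_esum//.
rewrite (_ : setT `*`` (fun _ : nat => [set: nat]) = setT); last first.
  by apply/seteqP; split.
have bf : set_bij [set: nat] [set: nat * nat] f by exact: bij.
rewrite (reindex_esum _ _ _ _ bf) -nneseries_esumT; last by [].
apply: (@leb_outer_le_cover _ _ _ (fun k => (G (f k).1 (f k).2).1)
  (fun k => (G (f k).1 (f k).2).2)) => z [i _ /(PG i).1[j _ zij]].
by exists (f^-1%FUN (i, j)) => //=; rewrite invK ?inE.
Qed.

HB.instance Definition _ (R : realType) (d : nat) :=
  isOuterMeasure.Build R 'rV[R]_d.+1 (@leb_outer R d.+1)
    (@leb_outer_set0 R d) (@leb_outer_ge0 R d.+1) (@le_leb_outer R d.+1)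
    (@leb_outer_sigma_subadditive R d.+1).

(** * Diagonal maps and reflections *)

Definition dscale (R : realType) d (l : 'I_d -> R) (z : 'rV[R]_d) : 'rV[R]_d :=
  \row_i (l i * z 0 i).

Lemma dscale_signK (R : realType) d (l : 'I_d -> R) : (forall i, `|l i| = 1) ->
  involutive (dscale l).
Proof.
move=> l1 z; apply/rowP => i; rewrite !mxE mulrA.
by rewrite -expr2 -real_normK ?num_real// l1 expr1n mul1r.
Qed.

Lemma leb_outer_dscale_aux (R : realType) d (l : 'I_d -> R) (A : set 'rV[R]_d)
    (q : R) : (forall i, l i != 0) -> 1 < q ->
  (leb_outer (dscale l @` A)
     <= ((\prod_i `|l i|) * q ^+ d)%:E * leb_outer A)%E.
Proof.
move=> l0 q1; have q0 : 0 < q by rewrite (lt_trans _ q1).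
set C := _ * _; have C0 : 0 < C.
  by rewrite mulr_gt0 ?exprn_gt0// prodr_gt0// => i _; rewrite normr_gt0.
rewrite -lee_pdivrMl//.
apply: leb_outer_glb => a b Aab; rewrite lee_pdivrMl//.
rewrite -nneseriesZl; last by move=> k _; rewrite lee_fin boxvol_ge0.
(* A reflection turns [a, b) into (-b, -a]; enlarging the sides by the factor [q]
   makes the image fit into a half-open box again. *)
pose a' k : 'rV[R]_d :=
  \row_i (if 0 < l i then l i * a k 0 i else l i * b k 0 i).
pose b' k : 'rV[R]_d := \row_i (if 0 < l i then l i * b k 0 i
  else l i * a k 0 i + (q - 1) * (`|l i| * (b k 0 i - a k 0 i))).
apply: (@le_trans _ _ (\sum_(0 <= k <oo) (boxvol (a' k) (b' k))%:E)%E).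
  apply: leb_outer_le_cover => _ [z Az <-].
  have [k _ zk] := Aab _ Az; exists k => // i; rewrite !mxE.
  have /andP[az zb] := zk i.
  case: ltP => li; first by rewrite ler_pM2l// az ltr_pM2l.
  have {}li : l i < 0 by rewrite lt_neqAle l0.
  rewrite ler_nM2l// (ltW zb)/= ltr_pwDr ?ler_nM2l//.
  by rewrite !mulr_gt0 ?subr_gt0 ?normr_gt0 ?(le_lt_trans az).
apply: lee_nneseries => [k _ _|k _]; first by rewrite lee_fin boxvol_ge0.
rewrite -EFinM lee_fin /C /boxvol.
have -> : q ^+ d = \prod_(i < d) q by rewrite prodr_const card_ord.
rewrite -!big_split/=; apply: ler_prod => i _; rewrite le_max lexx/= !mxE.
set u := b k 0 i; set v := a k 0 i; rewrite -(mulrA _ q).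
have -> : (if 0 < l i then l i * u else l i * v + (q - 1) * (`|l i| * (u - v)))
    - (if 0 < l i then l i * v else l i * u) =
    `|l i| * ((if 0 < l i then 1 else q) * (u - v)).
  by case: ltP => li; [rewrite gtr0_norm//|rewrite ler0_norm//]; ring.
rewrite -{1}(mulr0 `|l i|) -maxr_pMr// ler_wpM2l//.
have [uv|vu] := leP 0 (u - v).
  rewrite max_r; last by case: ifP => _; rewrite ?mul1r// mulr_ge0// ltW.
  by rewrite ler_wpM2r//; case: ifP => // _; exact: ltW.
by rewrite mulr0 ge_max lexx/=; case: ifP => _; nra.
Qed.

Lemma leb_outer_dscale (R : realType) d (l : 'I_d.+1 -> R)
    (A : set 'rV[R]_d.+1) : (forall i, l i != 0) ->
  (leb_outer (dscale l @` A) <= (\prod_i `|l i|)%:E * leb_outer A)%E.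
Proof.
move=> l0; apply/lee_mul01Pr; first exact: leb_outer_ge0.
(* The enlargement of the boxes costs [q ^+ d.+1]; this root makes the cost exactly [r^-1], where
   [r < 1] is arbitrary. *)
move=> r /andP[r0 r1]; pose q := (r^-1) `^ (d.+1%:R^-1).
have r1' : 1 < r^-1 by rewrite invf_gt1.
have q1 : 1 < q.
  have := @gt0_ltr_powR R d.+1%:R^-1 _ 1 r^-1 _ _ r1'; rewrite powR1; apply;
    by rewrite ?nnegrE ?invr_ge0 ?invr_gt0 ?ltr0n ?(ltW r0).
have qd : q ^+ d.+1 = r^-1.
  rewrite -powR_mulrn ?powR_ge0// -powRrM mulVf ?pnatr_eq0//.
  by rewrite powRr1// invr_ge0 ltW.
have := leb_outer_dscale_aux A l0 q1; rewrite qd => h.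
by rewrite -lee_pdivlMl// muleA -EFinM mulrC.
Qed.

(** A reflection is an involution whose determinant has modulus 1, so the determinant bound, applied
    to [A] and to its preimage, gives both inequalities. *)
Lemma leb_outer_dscale_sign (R : realType) d (l : 'I_d.+1 -> R)
    (A : set 'rV[R]_d.+1) :
  (forall i, `|l i| = 1) -> leb_outer (dscale l @^-1` A) = leb_outer A.
Proof.
move=> l1; have l0 i : l i != 0 by rewrite -normr_eq0 l1 oner_eq0.
have lK := dscale_signK l1.
have le A' : (leb_outer (dscale l @` A') <= leb_outer A')%E.
  by apply: le_trans (leb_outer_dscale _ l0) _; rewrite big1 ?mul1e.
apply/eqP; rewrite eq_le; apply/andP; split.
  apply: le_trans (le A); apply: le_leb_outer => z Az.
  by exists (dscale l z); rewrite ?lK.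
apply: le_trans (le (dscale l @^-1` A)); apply: le_leb_outer => z Az.
by exists (dscale l z); rewrite /= ?lK.
Qed.

(** * Measurability of coordinate half-spaces *)

Lemma boxvol_split (R : realType) d (a b : 'rV[R]_d) (i : 'I_d) (c : R) :
  boxvol a (\row_j (if j == i then Num.min (b 0 j) c else b 0 j)) +
  boxvol (\row_j (if j == i then Num.max (a 0 j) c else a 0 j)) b = boxvol a b.
Proof.
have D1 a' b' : boxvol a' b' = Num.max 0 (b' 0 i - a' 0 i) *
    \prod_(j < d | j != i) Num.max 0 (b' 0 j - a' 0 j).
  by rewrite /boxvol (bigD1 i).
rewrite !D1 !mxE eqxx.
set p1 := \prod_(_ < _ | _) _; set p2 := \prod_(_ < _ | _) _.
set p := \prod_(_ < _ | _) Num.max 0 (b _ _ - a _ _).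
have -> : p1 = p by apply: eq_bigr => j /negPf ji; rewrite !mxE ji.
have -> : p2 = p by apply: eq_bigr => j /negPf ji; rewrite !mxE ji.
rewrite -mulrDl; congr (_ * _).
set x := a 0 i; set y := b 0 i.
rewrite !maxEle !minEle.
by case: (leP y c) => ?; case: (leP x c) => ?; repeat case: leP => ?; lra.
Qed.

(** Every box of a cover of [X] is cut at [c]: the lower pieces cover the part of [X] in the
    half-space, the upper pieces cover the rest. Half-open boxes make the cut exact, a point with
    [z 0 i = c] going to the upper piece. *)
Lemma caratheodory_halfspace (R : realType) d (i : 'I_d.+1) (c : R) :
  (@leb_outer R d.+1).-caratheodory [set z | z 0 i < c].
Proof.
apply: le_caratheodory_measurable => X.
apply: leb_outer_glb => a b Xab.
pose b' k : 'rV[R]_d.+1 :=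
  \row_j (if j == i then Num.min (b k 0 j) c else b k 0 j).
pose a' k : 'rV[R]_d.+1 :=
  \row_j (if j == i then Num.max (a k 0 j) c else a k 0 j).
under eq_eseriesr => k _ do rewrite -(boxvol_split _ _ i c) EFinD.
rewrite nneseriesD => [|k _ _|k _ _]; rewrite ?lee_fin ?boxvol_ge0//.
apply: leeD; apply: leb_outer_le_cover => z [Xz /= zc];
  have [k _ zk] := Xab _ Xz; exists k => // j; rewrite !mxE;
  have /andP[az zb] := zk j; case: eqP => [ji|_]; rewrite ?az ?zb//.
- by rewrite lt_min zb ji.
- by rewrite ge_max az ji leNgt; move/negP: zc => ->.
Qed.

(** * Lower bound for the outer measure of a box *)

Section box_cover.
Context {R : realType} {d : nat}.
Implicit Types (a b z : 'rV[R]_d).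

(* Side lengths for the coordinates below [j], indicators for the others: the
   covering inequality between indicators is integrated one coordinate at a
   time, so that only the Lebesgue measure of the line is needed. *)
Let factor (j : nat) a b z (i : 'I_d) : R :=
  if (i < j)%N then Num.max 0 (b 0 i - a 0 i)
  else \1_(`[a 0 i, b 0 i[%classic) (z 0 i).

Let hybrid j a b z : R := \prod_(i < d) factor j a b z i.

Let rest (j : 'I_d) a b z : R := \prod_(i < d | i != j) factor j a b z i.

Let factor_ge0 j a b z i : 0 <= factor j a b z i.
Proof. by rewrite /factor; case: ifP; rewrite ?le_max ?lexx. Qed.

Let hybrid_ge0 j a b z : 0 <= hybrid j a b z.
Proof. exact: prodr_ge0. Qed.

Let hybrid_upd (j : 'I_d) a b z t :
  hybrid j a b (\row_i (if i == j then t else z 0 i)) =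
  rest j a b z * \1_(`[a 0 j, b 0 j[%classic) t.
Proof.
rewrite /hybrid (bigD1 j)//= mulrC /factor ltnn !mxE eqxx; congr (_ * _).
by apply: eq_bigr => i /negPf ij; rewrite /factor !mxE ij.
Qed.

Let hybridS (j : 'I_d) a b z :
  hybrid j.+1 a b z = rest j a b z * Num.max 0 (b 0 j - a 0 j).
Proof.
rewrite /hybrid (bigD1 j)//= mulrC /factor ltnSn; congr (_ * _).
apply: eq_bigr => i ij; rewrite /factor ltnS leq_eqVlt.
by rewrite (negPf (ij : val i != val j)).
Qed.

Let integral_hybrid (j : 'I_d) a b z :
  (\int[lebesgue_measure]_t
     (hybrid j a b (\row_i (if i == j then t else z 0 i)))%:E
   = (hybrid j.+1 a b z)%:E)%E.
Proof.
under eq_integral => t _ do rewrite hybrid_upd EFinM.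
rewrite ge0_integralZl_EFin ?prodr_ge0//; last exact/measurable_EFinP.
rewrite integral_indic//= setIT lebesgue_measure_itv/= lte_fin hybridS EFinM.
congr (_ * _)%E; case: ltP => ab; first by rewrite max_r ?EFinB// subr_ge0 ltW.
by rewrite max_l// subr_le0.
Qed.

Let box_le_cover_hybrid a b (a_ b_ : nat -> 'rV[R]_d) :
  box a b `<=` \bigcup_k box (a_ k) (b_ k) -> forall j, (j <= d)%N -> forall z,
  ((hybrid j a b z)%:E <= \sum_(0 <= k <oo) (hybrid j (a_ k) (b_ k) z)%:E)%E.
Proof.
(* At level 0, if [z] is in the box, some box of the cover contributes 1. The inductive step
   integrates the level [j] inequality in coordinate [j] and exchanges sum and integral, all terms
   being nonnegative. *)
move=> cov; elim=> [_ z|j IH jd z].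
  have [zab|/existsNP[i zi]] := pselect (box a b z); last first.
    rewrite /hybrid (bigD1 i)//= {1}/factor indicE memNset ?mul0r.
      by apply: nneseries_ge0 => k _ _; rewrite lee_fin hybrid_ge0.
    by rewrite /= in_itv/=; exact/negP/negP/zi.
  have [k _ zk] := cov _ zab.
  have one a' b' : box a' b' z -> hybrid 0 a' b' z = 1.
    move=> zab'; rewrite /hybrid big1// => i _.
    by rewrite /factor indicE mem_set//= in_itv/=; exact: zab'.
  rewrite (nneseriesD1 (n := k))//=.
    rewrite (one a b)// (one (a_ k))// leeDl// nneseries_ge0// => m _ _.
    by rewrite lee_fin hybrid_ge0.
  by move=> m _; rewrite lee_fin hybrid_ge0.
pose j' := Ordinal jd.
have m_hybrid a' b' : measurable_fun setT
    (fun t => (hybrid j a' b' (\row_i (if i == j' then t else z 0 i)))%:E).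
  apply/measurable_EFinP; under eq_fun do rewrite (hybrid_upd j').
  exact: measurable_funM.
rewrite -(integral_hybrid j') /=.
under eq_eseriesr => k _ do rewrite -(integral_hybrid j').
rewrite -integral_nneseries//=.
- apply: ge0_le_integral => //.
  + by move=> t _; rewrite lee_fin hybrid_ge0.
  + exact: m_hybrid.
  + apply: (ge0_emeasurable_sum (P := xpredT)) => [k t _ _|k _].
      by rewrite lee_fin hybrid_ge0.
    exact: m_hybrid.
  + by move=> t _; exact: IH (ltnW jd) _.
- by move=> k; exact: m_hybrid.
- by move=> k t _; rewrite lee_fin hybrid_ge0.
Qed.

(** At level [d] all factors are side lengths, so [hybrid] is the volume, whatever the base point.
    This bound later makes the measure of the ball positive. *)
Lemma boxvol_le_leb_outer a b : ((boxvol a b)%:E <= leb_outer (box a b))%E.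
Proof.
apply: leb_outer_glb => a_ b_ cov.
have := box_le_cover_hybrid cov (leqnn d) 0.
have hE a' b' : hybrid d a' b' 0 = boxvol a' b'.
  by apply: eq_bigr => i _; rewrite /factor ltn_ord.
by rewrite hE; under eq_eseriesr => k _ do rewrite hE.
Qed.

End box_cover.

(** * Volume of slabs of the l_p ball *)

Lemma lpnorm_ge0 (R : realType) d (p : \bar R) (z : 'rV[R]_d) : 0 <= lpnorm p z.
Proof.
by case: p => [r| |]; rewrite /lpnorm ?powR_ge0//; apply: bigmax_ge_id.
Qed.

Lemma ler_norm_bigmax (R : realType) d (z : 'rV[R]_d) i :
  `|z 0 i| <= \big[Num.max/0]_(i < d) `|z 0 i|.
Proof. exact: le_bigmax. Qed.

Lemma lpball_finE (R : realType) d (r : R) (z : 'rV[R]_d) : 0 < r ->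
  lpball r%:E z <-> \sum_(i < d) `|z 0 i| `^ r <= 1.
Proof.
move=> r0; rewrite /lpball/=; set S := \sum_(_ < _) _.
have S0 : 0 <= S by apply: sumr_ge0 => i _; exact: powR_ge0.
split=> h.
  have : (S `^ r^-1) `^ r <= 1 `^ r.
    by apply: ge0_ler_powR; rewrite ?nnegrE ?powR_ge0 ?(ltW r0).
  by rewrite -powRrM mulVf ?gt_eqF// powRr1// powR1.
have : S `^ r^-1 <= 1 `^ r^-1.
  by apply: ge0_ler_powR; rewrite ?nnegrE ?invr_ge0 ?(ltW r0).
by rewrite powR1.
Qed.

Lemma lpball_ooE (R : realType) d (z : 'rV[R]_d) :
  lpball +oo%E z <-> forall i, `|z 0 i| <= 1.
Proof.
rewrite /lpball/=; split=> [h i|h].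
  exact: le_trans (ler_norm_bigmax z i) h.
by apply: bigmax_le => // i _; exact: h.
Qed.

Lemma lpball_le1 (R : realType) d (p : \bar R) (z : 'rV[R]_d) i : (1 <= p)%E ->
  lpball p z -> `|z 0 i| <= 1.
Proof.
case: p => [r| |]// => [|_ /lpball_ooE//].
rewrite lee_fin => r1; have r0 : 0 < r by rewrite (lt_le_trans _ r1).
move=> /(lpball_finE _ r0) h; rewrite leNgt; apply/negP => z1.
have : 1 < \sum_(i < d) `|z 0 i| `^ r.
  rewrite (bigD1 i)//= ltr_wpDr//.
    by apply: sumr_ge0 => k _; exact: powR_ge0.
  have := gt0_ltr_powR r0 _ _ z1; rewrite powR1; apply; rewrite nnegrE//.
by rewrite ltNge h.
Qed.

Lemma lpnorm_dscale_sign (R : realType) d (p : \bar R) (l : 'I_d -> R)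
    (z : 'rV[R]_d) : (forall i, `|l i| = 1) ->
  lpnorm p (dscale l z) = lpnorm p z.
Proof.
move=> l1; have E i : `|dscale l z 0 i| = `|z 0 i|.
  by rewrite mxE normrM l1 mul1r.
case: p => [r| |]; rewrite /lpnorm.
- by congr (_ `^ _); apply: eq_bigr => i _; rewrite E.
- by apply: eq_bigr => i _; rewrite E.
- by apply: eq_bigr => i _; rewrite E.
Qed.

Lemma powR_ge_linear (R : realType) (u r : R) : 0 <= u -> 1 <= r ->
  r * (u - 1) <= u `^ r.
Proof.
move=> u0; rewrite le_eqVlt => /predU1P[<-|r1].
  by rewrite powRr1// mul1r lerBlDr lerDl.
have r0 : 0 < r by rewrite (lt_trans _ r1).
have q0 : 0 < 1 - r^-1 by rewrite subr_gt0 invf_lt1.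
have := @conjugate_powR _ u 1 r (1 - r^-1)^-1 u0 ler01 r0.
rewrite invr_gt0 invrK subrKC powR1 mulr1 mul1r => /(_ q0 erefl).
rewrite -lerBlDr ler_pdivlMr//; apply: le_trans.
have rr : r^-1 * r = 1 by rewrite mulVf ?gt_eqF.
by rewrite !mulrBl rr mul1r; nra.
Qed.

(* [A] lies in the image of the ball under the diagonal map with entry
   [e^(y/r)] everywhere, times [k] at [j]. *)
Lemma leb_outer_lpball_slab (R : realType) d (r k y : R) (j : 'I_d.+1)
    (A : set 'rV[R]_d.+1) : 1 <= r -> 0 < k -> A `<=` lpball r%:E ->
  (forall z, A z -> (`|z 0 j| / k) `^ r - `|z 0 j| `^ r <= y) ->
  (leb_outer A <= (k * expR (d.+1%:R * y / r))%:E *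
    leb_outer (@lpball R d.+1 r%:E))%E.
Proof.
move=> r1 k0 AB Ay; have r0 : 0 < r by rewrite (lt_le_trans _ r1).
pose m (i : 'I_d.+1) := if i == j then k else 1.
have m0 i : 0 < m i by rewrite /m; case: ifP.
pose l i := expR (y / r) * m i.
have l0 i : 0 < l i by rewrite mulr_gt0 ?expR_gt0.
have -> : k * expR (d.+1%:R * y / r) = \prod_i `|l i|.
  under eq_bigr => i _ do rewrite gtr0_norm//.
  rewrite big_split/= prodr_const card_ord -expRM_natl mulrA mulrC.
  by congr (_ * _); rewrite (bigD1 j)//= /m eqxx big1 ?mulr1// => i /negPf ->.
apply: le_trans (leb_outer_dscale _ _) => [|i]; last by rewrite gt_eqF.
apply: le_outer_measure => z Az.
exists (dscale (fun i => (l i)^-1) z); last first.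
  by apply/rowP => i; rewrite !mxE mulrA divff ?mul1r// gt_eqF.
apply/lpball_finE => //.
have -> : \sum_(i < d.+1) `|dscale (fun i => (l i)^-1) z 0 i| `^ r =
    expR (- y) * \sum_(i < d.+1) (`|z 0 i| / m i) `^ r.
  rewrite mulr_sumr; apply: eq_bigr => i _.
  have -> : `|dscale (fun i => (l i)^-1) z 0 i| =
      expR (- y / r) * (`|z 0 i| / m i).
    rewrite mxE normrM ger0_norm ?invr_ge0 ?(ltW (l0 i))// /l invfM -expRN mulNr.
    by rewrite -mulrA (mulrC (m i)^-1).
  rewrite powRM ?divr_ge0 ?expR_ge0 ?(ltW (m0 i))//.
  by rewrite -expRM mulfVK ?gt_eqF.
rewrite (bigD1 j)//= /m eqxx.
have := AB _ Az; move=> /(lpball_finE _ r0); rewrite (bigD1 j)//=.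
set S := (X in _ + X <= 1); set S' := (X in _ * (_ + X)).
have -> : S' = S by apply: eq_bigr => i /negPf ->; rewrite divr1.
(* Membership of the rescaled point amounts to [(|z_j| / k)^r + S <= e^y]. The left side is at most
   [1 + y], since [|z_j|^r + S <= 1]. *)
move=> h; have := Ay _ Az; set t := _ `^ r => tS.
rewrite expRN -ler_pdivlMl ?invr_gt0 ?expR_gt0// invrK mulr1.
by apply: le_trans (expR_ge1Dx y); lra.
Qed.

Lemma inv_exp_scaleM (R : realType) (n : nat) (r h : R) : (0 < n)%N -> 0 < r ->
  0 <= h -> (n%:R `^ inv_exp r%:E * h) `^ r = n%:R * h `^ r.
Proof.
move=> n0 r0 h0; rewrite powRM ?powR_ge0//= -powRrM mulVf ?gt_eqF//.
by rewrite powRr1.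
Qed.

(** For finite [r], with [n = d.+1], the set satisfies [|z_j|^r >= u^r / n], and halving [z_j]
    removes at least half of this power. The slab bound with [k = 2] and [y = - u^r / (2 n)] gives
    the factor [2 exp (- u^r / (2 r))]. For the cube, the bound is trivial when [u <= 1] and the set
    is empty otherwise. *)
Lemma lpball_tail (R : realType) d (p : \bar R) (j : 'I_d.+1) (u : R) :
  (1 <= p)%E -> 0 <= u ->
  (leb_outer (lpball p `&` [set z : 'rV_d.+1 |
      (u <= d.+1%:R `^ inv_exp p * `|z 0 j|)%R])
    <= (2 * expR (- ((u - 1) / 2)))%:E * leb_outer (@lpball R d.+1 p))%E.
Proof.
case: p => [r| |]//.
  rewrite lee_fin => r1 u0; have r0 : 0 < r by rewrite (lt_le_trans _ r1).
  have n0 : 0 < d.+1%:R :> R by rewrite ltr0n.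
  apply: le_trans.
    apply: (@leb_outer_lpball_slab _ _ r 2 (- (u `^ r / (2 * d.+1%:R))) j) => //.
    move=> z [_ /= uz]; set h := `|z 0 j|.
      have h0 : 0 <= h by exact: normr_ge0.
      have : u `^ r <= (d.+1%:R `^ inv_exp r%:E * h) `^ r.
        by apply: ge0_ler_powR; rewrite ?nnegrE ?mulr_ge0 ?powR_ge0 ?(ltW r0).
      rewrite inv_exp_scaleM// -ler_pdivrMl// => uh.
      rewrite powRM ?invr_ge0//.
      have h2 : 2^-1 `^ r <= 2^-1 :> R.
        by apply: ge1r_powR => //; rewrite invr_gt0 invf_le1 ?ltr0n ?ler1n.
      have := powR_ge0 h r; set H := h `^ r in uh * => H0.
      have := ler_wpM2l H0 h2; set t := _ * 2^-1 `^ r => Ht.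
      rewrite (_ : u `^ r / _ = d.+1%:R^-1 * u `^ r / 2); last first.
        by rewrite invfM; ring.
      set w := _^-1 * _ in uh *; lra.
  apply: lee_wpmul2r; first exact: leb_outer_ge0.
  rewrite lee_fin ler_pM2l// ler_expR mulrN mulNr lerN2.
  rewrite (_ : _ / r = u `^ r / r / 2); last by field; rewrite !gt_eqF.
  by rewrite ler_pM2r// ler_pdivlMr// mulrC powR_ge_linear.
move=> _ u0; have [u1|u1] := leP u 1.
  apply: (@le_trans _ _ (leb_outer (@lpball R d.+1 +oo%E))).
    by apply: le_leb_outer => z [].
  rewrite -{1}[leb_outer _]mul1e; apply: lee_wpmul2r; first exact: leb_outer_ge0.
  rewrite lee_fin; have : 1 <= expR (- ((u - 1) / 2)).
    by rewrite -[leLHS]expR0 ler_expR; lra.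
  lra.
rewrite (_ : _ `&` _ = set0).
  by rewrite leb_outer_set0 mule_ge0 ?leb_outer_ge0// lee_fin mulr_ge0 ?expR_ge0.
rewrite -subset0 => z [/lpball_ooE/(_ j) zj /=]; rewrite powRr0 mul1r => uz.
by have := lt_le_trans u1 (le_trans uz zj); rewrite ltxx.
Qed.

(** For finite [r], dividing [z_j] by [s] leaves [(|z_j| / s)^r <= 1 / n] with [n = d.+1], so the
    slab bound applies with [k = s] and [y = 1 / n]; the remaining factor is [exp (1 / r) <= e]. For
    the cube, scaling the single coordinate [j] by [s] suffices. *)
Lemma lpball_small (R : realType) d (p : \bar R) (j : 'I_d.+1) (s : R) :
  (1 <= p)%E -> 0 < s ->
  (leb_outer (lpball p `&` [set z : 'rV_d.+1 |
      (d.+1%:R `^ inv_exp p * `|z 0 j| <= s)%R])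
    <= (s * expR 1)%:E * leb_outer (@lpball R d.+1 p))%E.
Proof.
case: p => [r| |]//.
  rewrite lee_fin => r1 s0; have r0 : 0 < r by rewrite (lt_le_trans _ r1).
  have n0 : 0 < d.+1%:R :> R by rewrite ltr0n.
  apply: le_trans.
    apply: (@leb_outer_lpball_slab _ _ r s d.+1%:R^-1 j) => //.
    move=> z [_ /= zs]; set h := `|z 0 j|.
      have h0 : 0 <= h / s by rewrite divr_ge0 ?normr_ge0// ltW.
      rewrite lerBlDr (le_trans (y := d.+1%:R^-1))//; last first.
        by rewrite lerDl powR_ge0.
      rewrite -(mulr1 d.+1%:R^-1) ler_pdivlMl// -inv_exp_scaleM//.
      have hs : d.+1%:R `^ inv_exp r%:E * (h / s) <= 1.
        by rewrite mulrA ler_pdivrMr// mul1r.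
      have := ge0_ler_powR (ltW r0) _ _ hs; rewrite powR1; apply; rewrite nnegrE//.
      by rewrite mulr_ge0 ?powR_ge0.
  apply: lee_wpmul2r; first exact: leb_outer_ge0.
  by rewrite lee_fin ler_pM2l// ler_expR divff ?gt_eqF// mul1r invf_le1.
move=> _ s0; pose l (i : 'I_d.+1) := if i == j then s else 1.
have l0 i : 0 < l i by rewrite /l; case: ifP.
apply: (@le_trans _ _ (leb_outer (dscale l @` @lpball R d.+1 +oo%E))).
  apply: le_leb_outer => z [/lpball_ooE z1 /=]; rewrite powRr0 mul1r => zs.
  exists (dscale (fun i => (l i)^-1) z); last first.
    by apply/rowP => i; rewrite !mxE mulrA divff ?mul1r// gt_eqF.
  apply/lpball_ooE => i; rewrite mxE normrM ger0_norm ?invr_ge0 ?(ltW (l0 i))//.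
  rewrite ler_pdivrMl// mulr1 /l; case: eqP => [->//|_]; exact: z1.
apply: le_trans (leb_outer_dscale _ _) _; first by move=> i; rewrite gt_eqF.
apply: lee_wpmul2r; first exact: leb_outer_ge0.
under eq_bigr => i _ do rewrite gtr0_norm//.
rewrite lee_fin (bigD1 j)//= big1 /l ?eqxx; last by move=> i /negPf ->.
by rewrite ler_pM2l// -expR0 ler_expR.
Qed.

(** The ball contains the cube of side [1 / n], [n = d.+1]: there every [|z_i|] is at most 1, so
    [|z_i|^r <= |z_i|] and the sum is at most 1. *)
Lemma leb_outer_lpball_gt0 (R : realType) d (p : \bar R) : (1 <= p)%E ->
  (0 < leb_outer (@lpball R d.+1 p))%E.
Proof.
move=> p1; pose b : 'rV[R]_d.+1 := const_mx d.+1%:R^-1.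
have n0 : 0 < d.+1%:R :> R by rewrite ltr0n.
apply: (@lt_le_trans _ _ (boxvol 0 b)%:E).
  rewrite lte_fin; apply: prodr_gt0 => i _.
  by rewrite !mxE subr0 lt_max invr_gt0 n0 orbT.
apply: le_trans (boxvol_le_leb_outer _ _) _; apply: le_leb_outer => z zb.
have z1 i : `|z 0 i| <= d.+1%:R^-1.
  by have := zb i; rewrite !mxE => /andP[z0 /ltW]; rewrite ger0_norm.
have zle1 i : `|z 0 i| <= 1.
  by apply: le_trans (z1 i) _; rewrite invf_le1// ler1n.
case: p p1 => [r| |]//; last by move=> _; exact/lpball_ooE.
rewrite lee_fin => r1; apply/lpball_finE; first exact: lt_le_trans r1.
apply: (@le_trans _ _ (\sum_(i < d.+1) d.+1%:R^-1)); last first.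
  by rewrite sumr_const card_ord -[leLHS]mulr_natl divff ?gt_eqF.
apply: ler_sum => i _; apply: le_trans (z1 i).
have [->|z0] := eqVneq (z 0 i) 0.
  by rewrite normr0 powR0// gt_eqF// (lt_le_trans _ r1).
by apply: ge1r_powR => //; rewrite normr_gt0 z0 zle1.
Qed.

Lemma leb_outer_lpball_fin_num (R : realType) d (p : \bar R) : (1 <= p)%E ->
  leb_outer (@lpball R d.+1 p) \is a fin_num.
Proof.
move=> p1; rewrite ge0_fin_numE ?leb_outer_ge0//.
pose a k : 'rV[R]_d.+1 := if k is 0%N then const_mx (- 2) else 0.
pose b k : 'rV[R]_d.+1 := if k is 0%N then const_mx 2 else 0.
apply: le_lt_trans (leb_outer_le_cover (a := a) (b := b) _) _.
  move=> z zB; exists 0%N => // i; rewrite !mxE.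
  by have := lpball_le1 i p1 zB; rewrite ler_norml => /andP[? ?]; lra.
rewrite (nneseriesD1 (n := 0%N))//; last first.
  by move=> k _; rewrite lee_fin boxvol_ge0.
rewrite eseries0 ?adde0 ?ltry// => -[|k]//= _ _.
by rewrite /boxvol big_ord_recl subrr maxxx mul0r.
Qed.

Lemma leb_outer_fin_num_lpball (R : realType) d (p : \bar R)
    (X : set 'rV[R]_d.+1) : (1 <= p)%E -> X `<=` lpball p ->
  leb_outer X \is a fin_num.
Proof.
move=> p1 XB; rewrite ge0_fin_numE ?leb_outer_ge0//.
apply: le_lt_trans (le_leb_outer XB) _.
by rewrite -ge0_fin_numE ?leb_outer_ge0// leb_outer_lpball_fin_num.
Qed.

Lemma fine_le_leb_outer_lpball (R : realType) d (p : \bar R)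
    (X Y : set 'rV[R]_d.+1) : (1 <= p)%E -> X `<=` Y -> Y `<=` lpball p ->
  fine (leb_outer X) <= fine (leb_outer Y).
Proof.
move=> p1 XY YB.
have fY := leb_outer_fin_num_lpball p1 YB.
have fX := leb_outer_fin_num_lpball p1 (subset_trans XY YB).
by rewrite fine_le// le_leb_outer.
Qed.

(** * Integration over the l_p ball *)

(* [leb_outer] bundled as an outer measure, so that [caratheodory_type] finds
   the structure. *)
Definition leb_om (R : realType) d :
    {outer_measure set 'rV[R]_d.+1 -> \bar R} :=
  @leb_outer R d.+1.

Section mean.
Context {R : realType} {d : nat} {p : \bar R}.
Hypothesis p1 : (1 <= p)%E.

Notation space := (caratheodory_type (leb_om R d)).
Let mu : {measure set space -> \bar R} := leb_om R d.
Let B : set space := @lpball R d.+1 p.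
Implicit Types (f g : space -> R) (i j : 'I_d.+1).

Lemma measurable_coord i :
  measurable_fun setT (fun z : space => (z : 'rV_d.+1) 0 i).
Proof.
apply: (measurability _ (RGenInftyO.measurableE R)) => _ [_ [r ->] <-].
rewrite setTI (_ : _ @^-1` _ = [set z : 'rV[R]_d.+1 | z 0 i < r]).
  exact: caratheodory_halfspace.
by apply/seteqP; split => z /=; rewrite in_itv.
Qed.

Lemma measurable_abs_coord i :
  measurable_fun setT (fun z : space => `|(z : 'rV_d.+1) 0 i|).
Proof.
exact: measurableT_comp (@normr_measurable R setT) (measurable_coord i).
Qed.

Lemma measurable_lpball : measurable B.
Proof.
rewrite /B; case: p p1 => [r| |]//; rewrite ?lee_fin => r1.
  have r0 : 0 < r by rewrite (lt_le_trans _ r1).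
  have -> : @lpball R d.+1 r%:E =
      setT `&`
      [set z : space | \sum_(i < d.+1) `|(z : 'rV_d.+1) 0 i| `^ r <= 1].
    by rewrite setTI; apply/seteqP; split => z /lpball_finE; apply.
  apply: measurable_fun_le; [exact: measurableT| |exact: measurable_cst].
  apply: measurable_sum => i; apply: (measurableT_comp (measurable_powR r)).
  exact: measurable_abs_coord.
have -> : @lpball R d.+1 +oo%E =
    \bigcap_(i in [set: 'I_d.+1])
      (setT `&` [set z : space | `|(z : 'rV_d.+1) 0 i| <= 1]).
  apply/seteqP; split => z.
    by move=> /lpball_ooE h i _; split => //=; exact: h.
  by move=> h; apply/lpball_ooE => i; have [] := h i I.
apply: fin_bigcap_measurable => [|i _]; first exact: finite_finset.
apply: measurable_fun_le; [exact: measurableT| |exact: measurable_cst].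
exact: measurable_abs_coord.
Qed.

(** A class of integrands closed under sums and products, and integrable because the ball has finite
    measure; all integrability side conditions reduce to it. *)
Definition nice f :=
  measurable_fun setT f /\ exists M, forall z, B z -> `|f z| <= M.

Lemma nice_cst (c : R) : nice (fun=> c).
Proof. by split; [exact: measurable_cst|exists `|c|]. Qed.

Lemma nice_coord i : nice (fun z => (z : 'rV_d.+1) 0 i).
Proof.
split; first exact: measurable_coord.
by exists 1 => z; exact: lpball_le1.
Qed.

Lemma niceD f g : nice f -> nice g -> nice (fun z => f z + g z).
Proof.
move=> [mf [M fM]] [mg [N gN]]; split; first exact: measurable_funD.
exists (M + N) => z Bz; apply: le_trans (ler_normD _ _) _.
by rewrite lerD ?fM ?gN.
Qed.

Lemma niceM f g : nice f -> nice g -> nice (fun z => f z * g z).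
Proof.
move=> [mf [M fM]] [mg [N gN]]; split; first exact: measurable_funM.
by exists (M * N) => z Bz; rewrite normrM ler_pM ?fM ?gN.
Qed.

Lemma niceX f n : nice f -> nice (fun z => f z ^+ n).
Proof.
move=> nf; elim: n => [|n IH].
  by under [fun _ => _]eq_fun do rewrite expr0; exact: nice_cst.
by under [fun _ => _]eq_fun do rewrite exprS; exact: niceM.
Qed.

Lemma nice_sum I (r : seq I) (P : pred I) (F : I -> space -> R) :
  (forall k, nice (F k)) -> nice (fun z => \sum_(k <- r | P k) F k z).
Proof.
move=> nF; elim: r => [|k r IH].
  by under [fun _ => _]eq_fun do rewrite big_nil; exact: nice_cst.
under [fun _ => _]eq_fun do rewrite big_cons.
by case: (P k); [exact: niceD|exact: IH].
Qed.

Lemma nice_indic (A : set space) : measurable A -> nice \1_A.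
Proof.
move=> mA; split; first exact: measurable_indic.
by exists 1 => z _; rewrite indicE ger0_norm// lern1 leq_b1.
Qed.

Lemma nice_integrable f : nice f -> mu.-integrable B (EFin \o f).
Proof.
move=> [mf [M fM]]; apply: measurable_bounded_integrable.
- exact: measurable_lpball.
- by rewrite -ge0_fin_numE ?leb_outer_lpball_fin_num// leb_outer_ge0.
- exact: measurable_funTS.
- exists M; split; first exact: num_real.
  by move=> x Mx z Bz; apply: le_trans (ltW Mx); exact: fM.
Qed.

(** The integral is not divided by the volume of the ball, so that volume appears as a factor [V] in
    the moment bounds. *)
Definition mean f : R := (\int[mu]_(z in B) f z)%R.

Lemma meanD f g : nice f -> nice g ->
  mean (fun z => f z + g z) = mean f + mean g.
Proof.
move=> nf ng; apply: RintegralD; try exact: nice_integrable.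
exact: measurable_lpball.
Qed.

Lemma meanZ (c : R) f : nice f -> mean (fun z => c * f z) = c * mean f.
Proof.
move=> nf; apply: RintegralZl; first exact: measurable_lpball.
exact: nice_integrable.
Qed.

Lemma mean_sum I (r : seq I) (F : I -> space -> R) : (forall k, nice (F k)) ->
  mean (fun z => \sum_(k <- r) F k z) = \sum_(k <- r) mean (F k).
Proof.
move=> nF; elim: r => [|k r IH].
  rewrite big_nil; under [X in mean X]eq_fun do rewrite big_nil.
  by rewrite /mean Rintegral_cst ?mul0r//; exact: measurable_lpball.
rewrite big_cons -IH -(meanD (nF k) (nice_sum r xpredT nF)).
by congr mean; apply/funext => z; rewrite big_cons.
Qed.

Lemma ler_mean f g : nice f -> nice g -> (forall z, B z -> f z <= g z) ->
  mean f <= mean g.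
Proof.
move=> nf ng fg; apply: le_Rintegral => //; try exact: nice_integrable.
exact: measurable_lpball.
Qed.

Lemma mean_indic (A : set space) : measurable A ->
  mean \1_A = fine (mu (B `&` A)).
Proof.
move=> mA; rewrite /mean /Rintegral integral_indic//; last exact: measurable_lpball.
by rewrite setIC.
Qed.

(** The Caratheodory criterion for the preimage, tested on [X], is the criterion for [A] tested on
    the preimage of [X], since reflections preserve the outer measure. *)
Lemma measurable_dscale_sign (l : 'I_d.+1 -> R) : (forall i, `|l i| = 1) ->
  measurable_fun setT (dscale l : space -> space).
Proof.
move=> l1 _ A mA; rewrite setTI.
suff : (@leb_outer R d.+1).-caratheodory (dscale l @^-1` A) by [].
have {}mA : (@leb_outer R d.+1).-caratheodory A := mA.
move=> X.
have lK := dscale_signK l1.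
have E Y : dscale l @^-1` (dscale l @^-1` Y) = Y.
  by apply/seteqP; split => z /=; rewrite lK.
rewrite -(leb_outer_dscale_sign X l1) (mA (dscale l @^-1` X)).
rewrite -(leb_outer_dscale_sign (_ `&` A) l1).
by rewrite -(leb_outer_dscale_sign (_ `&` ~` A) l1) !preimage_setI E.
Qed.

(** Change of variables: a reflection preserves both the ball and the measure, so the pushforward
    measure is the original one. *)
Lemma mean_dscale_sign (l : 'I_d.+1 -> R) f :
  (forall i, `|l i| = 1) -> nice f ->
  mean (f \o dscale l) = mean f.
Proof.
move=> l1 nf; have [mf _] := nf; rewrite /mean /Rintegral; congr fine.
have BE : dscale l @^-1` B = B.
  by apply/seteqP; split => z; rewrite /B/= /lpball/= lpnorm_dscale_sign.
have ml := measurable_dscale_sign l1.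
rewrite -[in LHS]BE.
rewrite -(integral_pushforward (f := EFin \o f) ml).
- apply: eq_measure_integral => A mA _; exact: leb_outer_dscale_sign.
- exact/measurable_EFinP.
- rewrite BE.
  have -> : (EFin \o f) \o dscale l = EFin \o (f \o dscale l) by [].
  apply: nice_integrable; split; first exact: measurableT_comp.
  have [M fM] := nf.2; exists M => z Bz; apply: fM.
  by rewrite -BE in Bz.
- exact: measurable_lpball.
Qed.

End mean.

(** * Moments of linear forms *)

Ltac solve_nice := repeat lazymatch goal with
  | |- nice (fun z => @?f z + @?g z) => apply: (niceD (f := f) (g := g))
  | |- nice (fun z => @?f z * @?g z) => apply: (niceM (f := f) (g := g))
  | |- nice (fun z => @?f z ^+ ?n) => apply: (niceX n (f := f))
  | |- nice (fun=> ?c) => exact: (nice_cst c)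
  | |- nice _ => solve [auto]
  end.

(* Bounds for the moments of [d^(1/p) v_j], uniform in [d] and [p]: the second
   one is at least [moment2], the fourth one at most [moment4]. *)
Definition moment2 (R : realType) : R := (8 * expR 1 ^+ 2)^-1.

Definition moment4 (R : realType) : R := 45 * 8 ^+ 4 * expR 1.

Lemma moment2_gt0 (R : realType) : 0 < moment2 R.
Proof. by rewrite invr_gt0 mulr_gt0 ?exprn_gt0 ?expR_gt0. Qed.

Lemma moment4_gt0 (R : realType) : 0 < moment4 R.
Proof. by rewrite !mulr_gt0 ?exprn_gt0 ?expR_gt0. Qed.

Section moments.
Context {R : realType} {d : nat} {p : \bar R}.
Hypothesis p1 : (1 <= p)%E.

Notation space := (caratheodory_type (leb_om R d)).
Notation mean := (@mean R d p).
Notation nice := (@nice R d p).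
Let D : R := d.+1%:R `^ inv_exp p.
Let B : set space := @lpball R d.+1 p.
Let V : R := fine (leb_outer B).
Let y (j : 'I_d.+1) (z : space) : R := D * (z : 'rV_d.+1) 0 j.
Implicit Types (f : space -> R) (i j : 'I_d.+1).

Let D_gt0 : 0 < D. Proof. by rewrite powR_gt0// ltr0n. Qed.

Let V_gt0 : 0 < V.
Proof.
rewrite fine_gt0// leb_outer_lpball_gt0//.
by rewrite ltey_eq leb_outer_lpball_fin_num.
Qed.

Let nice_y j : nice (y j).
Proof. exact: niceM (nice_cst _) (nice_coord p1 j). Qed.

Let abs_y j z : `|y j z| = D * `|(z : 'rV_d.+1) 0 j|.
Proof. by rewrite normrM (ger0_norm (ltW D_gt0)). Qed.

Let measurable_abs_y j : measurable_fun setT (fun z => `|y j z|).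
Proof. exact: measurableT_comp (@normr_measurable R setT) (nice_y j).1. Qed.

Let mean_cst (c : R) : mean (fun=> c) = c * V.
Proof. by rewrite /mean Rintegral_cst//; exact: measurable_lpball. Qed.

Let fine_le_scale (A : set space) (c : R) :
  (leb_outer A <= c%:E * leb_outer B)%E -> fine (leb_outer A) <= c * V.
Proof.
have /fineK <- := @leb_outer_lpball_fin_num R d p p1 => h.
have fA : leb_outer A \is a fin_num.
  by rewrite ge0_fin_numE ?leb_outer_ge0// (le_lt_trans h)// -EFinM ltry.
by rewrite -lee_fin fineK// EFinM.
Qed.

(** The weights are dominated by a telescoping sequence. With [n = k + 1] the exponential is
    [e / exp (n / 2)], and [exp (n / 2) >= (n / 2)^6 / 6!]. Since [2 n^5 (n + 1) <= 4 n^6], the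
    constant is [4 * 720 * 2^6 = 45 * 8^4], times [e]. *)
Let tail_weight_le (k : nat) :
  k.+1%:R ^+ 4 * (2 * expR (- ((k%:R - 1) / 2))) <=
  moment4 R * (k.+1%:R^-1 - k.+2%:R^-1) :> R.
Proof.
set n : R := k.+1%:R; have n1 : 1 <= n by rewrite /n ler1n.
have -> : k.+2%:R = n + 1 by rewrite /n natr1.
have -> : k%:R = n - 1 by rewrite /n -natr1 addrK.
have -> : expR (- ((n - 1 - 1) / 2)) = expR 1 / expR (n / 2).
  by rewrite -expRB; congr expR; field.
have n2 : 0 <= n / 2 by rewrite divr_ge0// (le_trans _ n1).
have := expR_ge1Dxn 5 n2; rewrite (_ : 6`! = 720)%N//.
set E := expR (n / 2) => hE.
have E0 : 0 < E by exact: expR_gt0.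
have e0 : 0 < expR 1 :> R by exact: expR_gt0.
have n0 : 0 < n by lra.
pose N : R := 720 * 64; have N0 : 0 < N by rewrite mulr_gt0 ?ltr0n.
have h6 : n ^+ 6 <= N * E.
  have {}hE : n ^+ 6 / N <= E.
    apply: le_trans hE; rewrite (_ : _ / 720 = n ^+ 6 / N) ?lerDr//.
    by rewrite /N; field.
  by rewrite mulrC -ler_pdivrMr.
have key : n ^+ 4 * 2 / E <= 45 * 8 ^+ 4 * (n^-1 - (n + 1)^-1).
  have -> : n^-1 - (n + 1)^-1 = (n * (n + 1))^-1.
    by field; rewrite !gt_eqF//; lra.
  have n2' : 0 < n * (n + 1) by rewrite mulr_gt0// addr_gt0.
  rewrite ler_pdivrMr// (_ : _ * E = 45 * 8 ^+ 4 * E / (n * (n + 1)));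
    last by ring.
  rewrite ler_pdivlMr//.
  have : 0 <= n ^+ 5 * (n - 1) by rewrite mulr_ge0 ?exprn_ge0//; lra.
  have -> : n ^+ 4 * 2 * (n * (n + 1)) = 2 * n ^+ 6 + 2 * n ^+ 5 by ring.
  have -> : n ^+ 5 * (n - 1) = n ^+ 6 - n ^+ 5 by ring.
  by move: h6; rewrite /N; lra.
rewrite /moment4 (_ : n ^+ 4 * _ = expR 1 * (n ^+ 4 * 2 / E)); last by ring.
rewrite (_ : 45 * _ * _ * _ =
  expR 1 * (45 * 8 ^+ 4 * (n^-1 - (n + 1)^-1))); last by ring.
by rewrite ler_pM2l.
Qed.

Let sum_tail_weight_le (K : nat) :
  \sum_(k < K) k.+1%:R ^+ 4 * (2 * expR (- ((k%:R - 1) / 2))) <=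
  moment4 R :> R.
Proof.
apply: (@le_trans _ _ (\sum_(k < K)
    moment4 R * (k.+1%:R^-1 - k.+2%:R^-1))).
  by apply: ler_sum => k _; exact: tail_weight_le.
rewrite -mulr_sumr ler_piMr ?(ltW (moment4_gt0 R))//.
rewrite -(big_mkord xpredT (fun k => k.+1%:R^-1 - k.+2%:R^-1)).
under eq_bigr do rewrite -opprB.
rewrite sumrN telescope_sumr// opprB invr1 lerBlDr lerDl.
by rewrite invr_ge0.
Qed.

(** Integer layers: where the integer part of [|y j|] is [k], the fourth power is at most
    [(k + 1)^4], and the layer lies in the tail set [A k]. Finitely many layers suffice because
    [|y j| <= D] on the ball. *)
Lemma mean_y4_le j : mean (fun z => y j z ^+ 4) <= moment4 R * V.
Proof.
pose K := Num.bound D.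
pose A k : set space := [set z | k%:R <= `|y j z|].
have mA k : measurable (A k).
  rewrite -[A k]setTI; apply: measurable_fun_le.
  - exact: measurableT.
  - exact: measurable_cst.
  - exact: measurable_abs_y.
apply: (@le_trans _ _ (mean (fun z => \sum_(k < K) k.+1%:R ^+ 4 * \1_(A k) z))).
  apply: (ler_mean p1); [by solve_nice| |move=> z Bz].
    by apply: nice_sum => k; apply: niceM; [exact: nice_cst|exact: nice_indic].
  have yD : `|y j z| <= D.
    by rewrite abs_y ler_piMr ?(ltW D_gt0)// (lpball_le1 j p1).
  have y0 : 0 <= `|y j z| by [].
  have /andP[tl tu] := truncn_itv y0.
  have tK : (Num.truncn `|y j z| < K)%N.
    rewrite -(ltr_nat R); apply: le_lt_trans tl _; apply: le_lt_trans yD _.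
    by apply: archi_boundP; exact: ltW.
  rewrite (bigD1 (Ordinal tK))//= indicE mem_set//= mulr1.
  rewrite -[leLHS]addr0 lerD//.
    have -> : y j z ^+ 4 = `|y j z| ^+ 4.
      by rewrite -normrX ger0_norm// exprn_even_ge0.
    by rewrite ler_pXn2r ?nnegrE ?ler0n ?(ltW tu).
  by apply: sumr_ge0 => k _; rewrite mulr_ge0 ?exprn_ge0.
rewrite (mean_sum p1); last first.
  by move=> k; apply: niceM; [exact: nice_cst|exact: nice_indic].
under eq_bigr => k _ do
  rewrite (meanZ p1 _ (nice_indic (p := p) (mA k))) (mean_indic p1 (mA k)).
apply: le_trans (ler_wpM2r (ltW V_gt0) (sum_tail_weight_le K)).
rewrite mulr_suml; apply: ler_sum => k _; rewrite -[leRHS]mulrA.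
apply: ler_wpM2l; first by rewrite exprn_ge0.
apply: fine_le_scale.
apply: le_trans (lpball_tail j p1 (ler0n _ k)); apply: le_leb_outer.
by move=> z [Bz]; rewrite /A/= abs_y.
Qed.

Lemma mean_y2_ge j : moment2 R * V <= mean (fun z => y j z ^+ 2).
Proof.
have e0 : 0 < expR 1 :> R by exact: expR_gt0.
(* For this [s] the small-coordinate bound [s * e] equals 1/2, so [y j ^+ 2 >= s ^+ 2] on at least
   half of the ball, whence [moment2 = s ^+ 2 / 2]. *)
pose s : R := (2 * expR 1)^-1.
have s0 : 0 < s by rewrite invr_gt0 mulr_gt0.
pose A : set space := [set z | `|y j z| <= s].
have mA : measurable A.
  rewrite -[A]setTI; apply: measurable_fun_le.
  - exact: measurableT.
  - exact: measurable_abs_y.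
  - exact: measurable_cst.
have nA := nice_indic (p := p) mA.
have small : fine (leb_outer (B `&` A)) <= 2^-1 * V.
  rewrite (_ : 2^-1 = s * expR 1); last by rewrite /s invfM mulfVK ?gt_eqF.
  apply: fine_le_scale; apply: le_trans (lpball_small j p1 s0).
  by apply: le_leb_outer => z [Bz]; rewrite /A/= abs_y.
have : mean (fun z => s ^+ 2 + - s ^+ 2 * \1_A z) <= mean (fun z => y j z ^+ 2).
  apply: (ler_mean p1); [by solve_nice|by solve_nice|move=> z _].
  rewrite indicE; case: (boolP (z \in A)) => [_|zA].
    by rewrite mulr1 subrr sqr_ge0.
  rewrite mulr0 addr0 -(real_normK (num_real (y j z))).
  rewrite ler_pXn2r ?nnegrE ?(ltW s0)//.
  by move: zA; rewrite notin_setE /A/= => /negP; rewrite -ltNge => /ltW.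
apply: le_trans.
rewrite (meanD p1); [|by solve_nice|by solve_nice].
rewrite (meanZ p1 _ nA) (mean_indic p1 mA) mean_cst.
have : 0 <= s ^+ 2 * (2^-1 * V - fine (leb_outer (B `&` A))).
  by rewrite mulr_ge0 ?sqr_ge0// subr_ge0.
have -> : moment2 R = s ^+ 2 / 2.
  by rewrite /moment2 /s; field; rewrite gt_eqF.
set m := fine _; lra.
Qed.


(** * Second and fourth moments of weighted sums of coordinates *)

Section partial_sums.
Variable w : 'rV[R]_d.+1.

Let S (k : nat) (z : space) : R := \sum_(i < d.+1 | (i < k)%N) w 0 i * y i z.
Let W (k : nat) : R := \sum_(i < d.+1 | (i < k)%N) w 0 i ^+ 2.

Let nice_S k : nice (S k).
Proof. by apply: nice_sum => i; solve_nice. Qed.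

Let W_ge0 k : 0 <= W k.
Proof. by apply: sumr_ge0 => i _; rewrite sqr_ge0. Qed.

Let ltnSD1 (j i : 'I_d.+1) : (i < j.+1)%N && (i != j) = (i < j)%N.
Proof. by rewrite ltnS andbC ltn_neqAle. Qed.

Let S_succ j z : S j.+1 z = S j z + w 0 j * y j z.
Proof.
rewrite /S (bigD1 j)//= addrC; congr (_ + _).
by apply: eq_bigl => i; exact: ltnSD1.
Qed.

Let W_succ j : W j.+1 = W j + w 0 j ^+ 2.
Proof.
rewrite /W (bigD1 j)//= addrC; congr (_ + _).
by apply: eq_bigl => i; exact: ltnSD1.
Qed.

(* Averaging over the reflection of the [j]-th coordinate removes the odd
   powers of [y j]. *)
Let mean_S_reflect j n :
  mean (fun z => S j.+1 z ^+ n) =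
  mean (fun z => (S j z + - w 0 j * y j z) ^+ n).
Proof.
pose l (i : 'I_d.+1) : R := if i == j then -1 else 1.
have l1 i : `|l i| = 1 by rewrite /l; case: ifP; rewrite ?normrN normr1.
rewrite -(mean_dscale_sign p1 l1); last by solve_nice.
congr mean; apply/funext => z /=; rewrite S_succ; congr (_ ^+ _).
rewrite /y mxE /l eqxx mulN1r mulrN mulrN mulNr; congr (_ - _).
apply: eq_bigr => i ij; rewrite /y mxE.
case: eqP => [ij'|_]; last by rewrite mul1r.
by move: ij; rewrite ij' ltnn.
Qed.

Let mean_S2_succ j : mean (fun z => S j.+1 z ^+ 2) =
  mean (fun z => S j z ^+ 2) + w 0 j ^+ 2 * mean (fun z => y j z ^+ 2).
Proof.
have : mean (fun z => S j.+1 z ^+ 2) + mean (fun z => S j.+1 z ^+ 2) =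
    2 * (mean (fun z => S j z ^+ 2) + w 0 j ^+ 2 * mean (fun z => y j z ^+ 2)).
  rewrite {2}mean_S_reflect -(meanD p1); [|by solve_nice|by solve_nice].
  rewrite -(meanZ p1 (w 0 j ^+ 2)); last by solve_nice.
  rewrite -(meanD p1); [|by solve_nice|by solve_nice].
  rewrite -(meanZ p1); [|by solve_nice].
  by congr mean; apply/funext => z; rewrite S_succ; ring.
lra.
Qed.

(** Averaging with the reflected sum leaves only even powers. The coordinates are dependent in
    general, so the mixed term [6 w^2 S^2 y^2] is not factored but split by
    [2 S^2 y^2 <= eta S^4 + y^4 / eta]. *)
Let mean_S4_succ_le j eta : 0 < eta -> mean (fun z => S j.+1 z ^+ 4) <=
  (1 + 3 * w 0 j ^+ 2 * eta) * mean (fun z => S j z ^+ 4) +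
  (w 0 j ^+ 4 + 3 * w 0 j ^+ 2 / eta) * mean (fun z => y j z ^+ 4).
Proof.
move=> eta0.
have : mean (fun z => S j.+1 z ^+ 4) + mean (fun z => S j.+1 z ^+ 4) <=
  2 * ((1 + 3 * w 0 j ^+ 2 * eta) * mean (fun z => S j z ^+ 4) +
  (w 0 j ^+ 4 + 3 * w 0 j ^+ 2 / eta) * mean (fun z => y j z ^+ 4)).
  rewrite {2}mean_S_reflect -(meanD p1); [|by solve_nice|by solve_nice].
  rewrite -(meanZ p1); [|by solve_nice].
  rewrite -(meanZ p1); [|by solve_nice].
  rewrite -(meanD p1); [|by solve_nice|by solve_nice].
  rewrite -(meanZ p1); [|by solve_nice].
  apply: (ler_mean p1); [by solve_nice|by solve_nice|move=> z _].
  rewrite S_succ; set s := S j z; set u := y j z; set c := w 0 j.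
    have : 0 <= c ^+ 2 * (eta * (s ^+ 2 - u ^+ 2 / eta) ^+ 2).
      by rewrite mulr_ge0 ?sqr_ge0// mulr_ge0 ?sqr_ge0// ltW.
    have -> : c ^+ 2 * (eta * (s ^+ 2 - u ^+ 2 / eta) ^+ 2) =
        c ^+ 2 * eta * s ^+ 4 - 2 * (c ^+ 2 * (s ^+ 2 * u ^+ 2))
        + c ^+ 2 / eta * u ^+ 4 by field; rewrite gt_eqF.
    lra.
lra.
Qed.

Let mean_S4_le k : (k <= d.+1)%N ->
  mean (fun z => S k z ^+ 4) <= 9 * (moment4 R * V) * W k ^+ 2.
Proof.
set M := _ * V; have M0 : 0 <= M by rewrite mulr_ge0 ?ltW// moment4_gt0.
elim: k => [_|k IH kd].
  have -> : (fun z => S 0 z ^+ 4) = fun=> 0.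
    by apply/funext => z; rewrite /S big1 ?expr0n// => -[].
  by rewrite mean_cst mul0r mulr_ge0 ?sqr_ge0// mulr_ge0.
have {}IH := IH (ltnW kd).
pose j := Ordinal kd; rewrite (W_succ j).
have yM := mean_y4_le j; rewrite -/M in yM.
set c2 := w 0 j ^+ 2; have c0 : 0 <= c2 by rewrite sqr_ge0.
have c4 : w 0 j ^+ 4 = c2 ^+ 2 by rewrite /c2; ring.
move: (W_ge0 k) IH; rewrite le_eqVlt => /predU1P[W0|W0] IH.
  have S0 : mean (fun z => S k z ^+ 4) <= 0.
    by move: IH; rewrite -W0 expr0n mulr0.
  rewrite -W0 add0r; have [c20|c2n] := eqVneq c2 0.
    have := mean_S4_succ_le j ltr01; rewrite c4 -/c2 c20 -[nat_of_ord j]/k; lra.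
  have {}c0 : 0 < c2 by rewrite lt_neqAle eq_sym c2n.
  (* The fourth moment of [S k] vanishes here, and this [eta] turns the coefficient
     [c2^2 + 3 c2 / eta] of the last term into [9 c2^2]. *)
  have eta0 : 0 < 3 / (8 * c2) by rewrite divr_gt0// mulr_gt0.
  apply: le_trans (mean_S4_succ_le j eta0) _; rewrite c4 -/c2 -[nat_of_ord j]/k.
  rewrite (_ : 3 * c2 * _ = 9 / 8); last by field; rewrite gt_eqF.
  rewrite (_ : 3 * c2 / _ = 8 * c2 ^+ 2); last by field; rewrite gt_eqF.
  have := ler_wpM2l (sqr_ge0 c2) yM; lra.
(* With this [eta] the total is at most [M (9 W^2 + 18 c2 W + c2^2)], which is below
   [9 M (W + c2)^2]; the constant 9 is the one for which the cross terms agree. *)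
have eta0 : 0 < (3 * W k)^-1 by rewrite invr_gt0 mulr_gt0.
apply: le_trans (mean_S4_succ_le j eta0) _; rewrite c4 -/c2 -[nat_of_ord j]/k.
rewrite (_ : 3 * c2 * _ = c2 / W k); last by field; rewrite gt_eqF.
rewrite (_ : 3 * c2 / _ = 9 * c2 * W k); last by field; rewrite gt_eqF.
have h1 : (1 + c2 / W k) * mean (fun z => S k z ^+ 4) <=
    9 * M * (W k ^+ 2 + c2 * W k).
  rewrite (_ : 9 * M * (_ + _) = (1 + c2 / W k) * (9 * M * W k ^+ 2)).
    apply: ler_wpM2l IH; rewrite addr_ge0 ?divr_ge0 ?W_ge0//.
  by field; rewrite gt_eqF.
have h2 : (c2 ^+ 2 + 9 * c2 * W k) * mean (fun z => y j z ^+ 4) <=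
    (c2 ^+ 2 + 9 * c2 * W k) * M.
  apply: ler_wpM2l yM.
  by rewrite addr_ge0 ?sqr_ge0// mulr_ge0 ?W_ge0// mulr_ge0.
have h3 : 0 <= M * c2 ^+ 2 by rewrite mulr_ge0 ?sqr_ge0.
lra.
Qed.

Let mean_S2E k : (k <= d.+1)%N -> mean (fun z => S k z ^+ 2) =
  \sum_(i < d.+1 | (i < k)%N) w 0 i ^+ 2 * mean (fun z => y i z ^+ 2).
Proof.
elim: k => [_|k IH kd].
  have -> : (fun z => S 0 z ^+ 2) = fun=> 0.
    by apply/funext => z; rewrite /S big1 ?expr0n// => -[].
  by rewrite mean_cst mul0r big1// => -[].
rewrite (mean_S2_succ (Ordinal kd)) IH ?(ltnW kd)//.
rewrite [in RHS](bigD1 (Ordinal kd))//= addrC; congr (_ + _).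
by apply: eq_bigl => i; rewrite -(ltnSD1 (Ordinal kd)).
Qed.

Let X (z : space) : R := D * \sum_i w 0 i * (z : 'rV_d.+1) 0 i.
Let Wt : R := \sum_i w 0 i ^+ 2.

Let XE : X = S d.+1.
Proof.
apply/funext => z; rewrite /X mulr_sumr /S; apply: eq_big => i.
  by rewrite ltn_ord.
by move=> _; rewrite /y mulrCA.
Qed.

Let WE : Wt = W d.+1.
Proof. by apply: eq_bigl => i; rewrite ltn_ord. Qed.

(** The pointwise bound [u^2 <= 1 + u^4] reduces this to the fourth moment. *)
Let mean_y2_le j : mean (fun z => y j z ^+ 2) <= (1 + moment4 R) * V.
Proof.
rewrite mulrDl; apply: le_trans (lerD (lexx _) (mean_y4_le j)).
rewrite -mean_cst -(meanD p1); [|by solve_nice|by solve_nice].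
apply: (ler_mean p1); [by solve_nice|by solve_nice|move=> z _].
set u := y j z; have : 0 <= (u ^+ 2 - 1) ^+ 2 by exact: sqr_ge0.
have : 0 <= u ^+ 2 by exact: sqr_ge0.
have -> : u ^+ 4 = (u ^+ 2) ^+ 2 by ring.
nra.
Qed.

Lemma mean_linear2_le :
  mean (fun z => X z ^+ 2) <= (1 + moment4 R) * V * Wt.
Proof.
rewrite XE mean_S2E// mulr_sumr.
under eq_bigl do rewrite ltn_ord.
by apply: ler_sum => i _; rewrite mulrC ler_wpM2r ?sqr_ge0.
Qed.

Lemma mean_linear2_ge :
  moment2 R * V * Wt <= mean (fun z => X z ^+ 2).
Proof.
rewrite XE mean_S2E// mulr_sumr.
under [leRHS]eq_bigl do rewrite ltn_ord.
by apply: ler_sum => i _; rewrite mulrC ler_wpM2l ?sqr_ge0 ?mean_y2_ge.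
Qed.

Lemma mean_linear4_le :
  mean (fun z => X z ^+ 4) <= 9 * (moment4 R * V) * Wt ^+ 2.
Proof. by rewrite XE WE mean_S4_le. Qed.

Let nice_X : nice X. Proof. by rewrite XE. Qed.

(** Chebyshev: [t^2] times the indicator of [|X| >= t] is at most [X^2]. *)
Lemma lpball_linear_tail (t : R) : 0 < t ->
  t ^+ 2 * fine (leb_outer (B `&` [set z | t <= `|X z|])) <=
  (1 + moment4 R) * V * Wt.
Proof.
move=> t0; apply: le_trans mean_linear2_le.
pose A : set space := [set z | t <= `|X z|].
have mA : measurable A.
  rewrite -[A]setTI; apply: measurable_fun_le.
  - exact: measurableT.
  - exact: measurable_cst.
  - exact: measurableT_comp (@normr_measurable R setT) nice_X.1.
have nA := nice_indic (p := p) mA.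
rewrite -[fine _](mean_indic p1 mA) -(meanZ p1 _ nA).
apply: (ler_mean p1); [by solve_nice|by solve_nice|move=> z _].
rewrite indicE; case: (boolP (z \in A)) => [|_]; last first.
  by rewrite mulr0 sqr_ge0.
rewrite inE mulr1 /A/= => tX.
by rewrite -(real_normK (num_real (X z))) ler_pXn2r// nnegrE ltW.
Qed.

(* Paley-Zygmund, through the pointwise bound
   X^2 <= c W + (eta / W) X^4 + (W / (4 eta)) 1_(X^2 > c W). *)
Lemma lpball_linear_anticoncentration : 0 < Wt ->
  moment2 R ^+ 2 / (36 * moment4 R) * V <=
  fine (leb_outer (B `&` [set z | Num.sqrt (moment2 R / 4 * Wt) < X z])).
Proof.
move=> W0; move: (moment2_gt0 R) (moment4_gt0 R) mean_linear2_ge mean_linear4_le.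
move: (moment2 R) (moment4 R) => a M a0 M0 h2 h4.
pose c := a / 4; have c0 : 0 < c by rewrite divr_gt0.
pose G : set space := [set z | c * Wt < X z ^+ 2].
have mG : measurable G.
  rewrite (_ : G = ~` (setT `&` [set z | X z ^+ 2 <= c * Wt])).
    apply: measurableC; apply: measurable_fun_le.
    - exact: measurableT.
    - exact: (niceX 2 nice_X).1.
    - exact: measurable_cst.
  apply/seteqP; split => z; rewrite /G/=.
    by move=> h [_]; rewrite leNgt h.
  by move=> h; rewrite ltNge; apply/negP => h'; exact: h.
have nG := nice_indic (p := p) mG.
(* The term in [X^4] then contributes at most [a / 4 * V * Wt], as does the term in [c = a / 4].
   Half of the second moment is left for the indicator, which gives [g >= 2 * a * eta * V]. *)
pose eta := a / (36 * M); have eta0 : 0 < eta by rewrite divr_gt0// mulr_gt0.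
set g := fine (leb_outer (B `&` G)).
have gV : a ^+ 2 / (18 * M) * V <= g.
  have : mean (fun z => X z ^+ 2) <= c * Wt * V +
      (eta / Wt * mean (fun z => X z ^+ 4) + Wt / (4 * eta) * g).
    rewrite /g -[fine _](mean_indic p1 mG) -mean_cst.
    rewrite -(meanZ p1); [|by solve_nice].
    rewrite -(meanZ p1); [|by solve_nice].
    rewrite -(meanD p1); [|by solve_nice|by solve_nice].
    rewrite -(meanD p1); [|by solve_nice|by solve_nice].
    apply: (ler_mean p1); [by solve_nice|by solve_nice|move=> z _].
    rewrite indicE; case: (boolP (z \in G)) => [_|].
      have : 0 <= eta / Wt * (X z ^+ 2 - Wt / (2 * eta)) ^+ 2.
        by rewrite mulr_ge0 ?sqr_ge0// divr_ge0// ltW.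
      have -> : eta / Wt * (X z ^+ 2 - Wt / (2 * eta)) ^+ 2 =
          eta / Wt * X z ^+ 4 - X z ^+ 2 + Wt / (4 * eta).
        by field; rewrite !gt_eqF.
      have : 0 <= c * Wt by rewrite mulr_ge0// ltW.
      by rewrite mulr1; lra.
    rewrite notin_setE /G/= => /negP; rewrite -leNgt mulr0 addr0 => h.
    apply: le_trans h _; rewrite lerDl mulr_ge0//.
      by rewrite divr_ge0// ltW.
    by rewrite exprn_even_ge0.
  move: h2 => /le_trans /[apply].
  have {}h4 : eta / Wt * mean (fun z => X z ^+ 4) <= a / 4 * V * Wt.
    have := ler_wpM2l (ltW (divr_gt0 eta0 W0)) h4.
    rewrite (_ : eta / Wt * (9 * (M * V) * Wt ^+ 2) = a / 4 * V * Wt)//.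
    by rewrite /eta; field; rewrite !gt_eqF.
  move=> h.
  have {h}h4 : a * V * Wt <= c * Wt * V + (a / 4 * V * Wt + Wt / (4 * eta) * g).
    by apply: le_trans h _; rewrite lerD2l lerD2r.
  have : a / 2 * V <= g / (4 * eta).
    rewrite -(ler_pM2r W0); move: h4; rewrite /c.
    rewrite (_ : Wt / (4 * eta) * g = g / (4 * eta) * Wt); last first.
      by field; rewrite gt_eqF.
    lra.
  have eta4 : 0 < 4 * eta by rewrite mulr_gt0.
  rewrite (ler_pdivlMr _ _ eta4) (_ : a / 2 * V * _ = a ^+ 2 / (18 * M) * V)//.
  by rewrite /eta; field; rewrite gt_eqF.
(* The bound on [X ^+ 2] is two-sided. The symmetry [z -> -z] exchanges its two halves, so the
   one-sided event keeps at least half of the measure; hence 36 in place of 18. *)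
pose A : set 'rV[R]_d.+1 := B `&` [set z | Num.sqrt (c * Wt) < X z].
pose l (i : 'I_d.+1) : R := -1.
have l1 i : `|l i| = 1 by rewrite /l normrN normr1.
have XN z : X (dscale l z) = - X z.
  rewrite /X -mulrN -sumrN; congr (_ * _); apply: eq_bigr => i _.
  by rewrite mxE /l mulN1r mulrN.
have cov : B `&` G `<=` A `|` (dscale l @^-1` A).
  move=> z [Bz]; rewrite /G/= => cX.
  have {}cX : Num.sqrt (c * Wt) < `|X z|.
    by rewrite -sqrtr_sqr ltr_sqrt// (lt_trans _ cX)// mulr_gt0.
  have [X0|X0] := leP 0 (X z); [left|right]; split => //=.
  - by rewrite ger0_norm in cX.
  - by rewrite /B/= /lpball/= lpnorm_dscale_sign.
  - by rewrite XN -ltr0_norm.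
have : (leb_outer (B `&` G) <= leb_outer A + leb_outer A)%E.
  apply: le_trans (le_leb_outer cov) _.
  by rewrite -{2}(leb_outer_dscale_sign A l1); exact: outer_measureU2.
have fA : leb_outer A \is a fin_num.
  by apply: (leb_outer_fin_num_lpball p1) => z [].
have fG : leb_outer (B `&` G) \is a fin_num.
  by apply: (leb_outer_fin_num_lpball p1) => z [].
rewrite -(fineK fA) -(fineK fG) -EFinD lee_fin -/g => gA.
rewrite -/c -[X in _ <= fine (leb_outer X)]/A.
have -> : a ^+ 2 / (36 * M) * V = a ^+ 2 / (18 * M) * V / 2.
  by field; rewrite gt_eqF.
lra.
Qed.

End partial_sums.

End moments.

(** * Hoelder duality and the distance to the boundary *)

Lemma lpnormZ_le (R : realType) d (p : \bar R) (c : R) (z : 'rV[R]_d) :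
  (1 <= p)%E -> lpnorm p (c *: z) <= `|c| * lpnorm p z.
Proof.
have E i : `|(c *: z) 0 i| = `|c| * `|z 0 i| by rewrite mxE normrM.
case: p => [r| |]//.
  rewrite lee_fin => r1; have r0 : 0 < r by rewrite (lt_le_trans _ r1).
  rewrite /lpnorm; under eq_bigr => i _ do rewrite E powRM//.
  rewrite -mulr_sumr powRM ?powR_ge0 ?sumr_ge0//.
  by rewrite -powRrM divff ?gt_eqF// powRr1.
move=> _; apply: bigmax_le => [|i _]; first by rewrite mulr_ge0// lpnorm_ge0.
by rewrite E ler_wpM2l// ler_norm_bigmax.
Qed.

Lemma lpnorm_gt0 (R : realType) d (p : \bar R) (z : 'rV[R]_d) :
  (1 <= p)%E -> z != 0 -> 0 < lpnorm p z.
Proof.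
move=> p1 z0; have [i zi] : exists i, z 0 i != 0.
  apply: contrapT => h; move/eqP: z0; apply; apply/rowP => i; rewrite mxE.
  by apply: contrapT => /eqP zi; apply: h; exists i.
have {}zi : 0 < `|z 0 i| by rewrite normr_gt0.
case: p p1 => [r| |]//= => [_|_]; last first.
  exact: lt_le_trans zi (ler_norm_bigmax z i).
apply: powR_gt0; rewrite (bigD1 i)//= ltr_wpDr ?powR_gt0//.
by apply: sumr_ge0 => k _; exact: powR_ge0.
Qed.

Lemma lpnorm_powR (R : realType) d (r : R) (z : 'rV[R]_d) : 0 < r ->
  lpnorm r%:E z `^ r = \sum_i `|z 0 i| `^ r.
Proof.
move=> r0; rewrite /= -powRrM mulVf ?gt_eqF// powRr1//.
by apply: sumr_ge0 => i _; exact: powR_ge0.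
Qed.

Lemma sum_normalized_powR (R : realType) d (r : R) (z : 'rV[R]_d) : 1 <= r ->
  z != 0 -> \sum_i (`|z 0 i| / lpnorm r%:E z) `^ r = 1.
Proof.
move=> r1 z0; have r0 : 0 < r by rewrite (lt_le_trans _ r1).
have N0 : 0 < lpnorm r%:E z by rewrite lpnorm_gt0// lee_fin.
under eq_bigr => i _ do rewrite powRM ?invr_ge0 ?(ltW N0)//.
rewrite -mulr_suml -lpnorm_powR// -powRM ?invr_ge0 ?(ltW N0)//.
by rewrite divff ?gt_eqF// powR1.
Qed.

(** The three shapes of a conjugate pair: two finite exponents, and the two endpoint pairs, where
    the inverse of infinity counts as 0. *)
Variant conj_exp_spec (R : realType) : \bar R -> \bar R -> Prop :=
| ConjExpFin (r s : R) of 1 <= r & 1 < s & r^-1 + s^-1 = 1 :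
    conj_exp_spec r%:E s%:E
| ConjExp1oo : conj_exp_spec 1%:E +oo%E
| ConjExpoo1 : conj_exp_spec +oo%E 1%:E.

Lemma conj_expP (R : realType) (p p' : \bar R) : (1 <= p)%E -> (1 <= p')%E ->
  inv_exp p + inv_exp p' = 1 -> conj_exp_spec p p'.
Proof.
case: p => [r| |]//; case: p' => [s| |]//=; rewrite ?lee_fin.
- move=> r1 s1 rs; apply: ConjExpFin => //.
  have r0 : 0 < r^-1 by rewrite invr_gt0 (lt_le_trans _ r1).
  by rewrite -invf_lt1 ?(lt_le_trans _ s1)//; lra.
- move=> r1 _; rewrite addr0 => /eqP; rewrite invr_eq1 => /eqP ->.
  exact: ConjExp1oo.
- move=> _ s1; rewrite add0r => /eqP; rewrite invr_eq1 => /eqP ->.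
  exact: ConjExpoo1.
- by move=> _ _ /eqP; rewrite add0r eq_sym oner_eq0.
Qed.

(** For finite exponents, Young's inequality is applied to the coordinates divided by their norms;
    the sum of the right sides is [1/r + 1/s = 1]. The endpoint cases bound one factor by its
    maximum. *)
Lemma hoelder_lpnorm (R : realType) d (p p' : \bar R) (w z : 'rV[R]_d) :
  (1 <= p)%E -> (1 <= p')%E -> inv_exp p + inv_exp p' = 1 ->
  `|\sum_i w 0 i * z 0 i| <= lpnorm p' w * lpnorm p z.
Proof.
move=> p1 p1' pp'.
have [->|w0] := eqVneq w 0.
  rewrite big1 ?normr0 ?mulr_ge0 ?lpnorm_ge0// => i _.
  by rewrite mxE mul0r.
have [->|z0] := eqVneq z 0.
  rewrite big1 ?normr0 ?mulr_ge0 ?lpnorm_ge0// => i _.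
  by rewrite mxE mulr0.
have Nw := lpnorm_gt0 p1' w0; have Nz := lpnorm_gt0 p1 z0.
apply: le_trans (ler_norm_sum _ _ _) _.
under eq_bigr => i _ do rewrite normrM.
case: (conj_expP p1 p1' pp') Nw Nz => [r s r1 s1 rs| |] Nw Nz.
- have r0 : 0 < r by rewrite (lt_le_trans _ r1).
  have s0 : 0 < s by rewrite (lt_trans _ s1).
  have := sum_normalized_powR (ltW s1) w0; have := sum_normalized_powR r1 z0.
  move: (lpnorm s%:E w) (lpnorm r%:E z) Nw Nz => M N M0 N0 Sz Sw.
  have MN : 0 < M * N by exact: mulr_gt0.
  rewrite -[leRHS]mulr1 -(ler_pdivrMl _ _ MN) mulr_sumr.
  apply: (@le_trans _ _
      (\sum_i ((`|z 0 i| / N) `^ r / r + (`|w 0 i| / M) `^ s / s))).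
    apply: ler_sum => i _; rewrite invfM mulrACA mulrC (mulrC M^-1) (mulrC N^-1).
    by apply: conjugate_powR => //; rewrite divr_ge0// ltW.
  by rewrite big_split/= -!mulr_suml Sz Sw !mul1r rs.
- rewrite /= invr1 powRr1; last by apply: sumr_ge0 => i _; rewrite powR_ge0.
  rewrite mulr_sumr; apply: ler_sum => i _.
  by rewrite powRr1// ler_wpM2r// ler_norm_bigmax.
- rewrite /= invr1 powRr1; last by apply: sumr_ge0 => i _; rewrite powR_ge0.
  rewrite mulr_suml; apply: ler_sum => i _.
  by rewrite powRr1// ler_wpM2l// ler_norm_bigmax.
Qed.

(** The extremal vectors are [sg(w_i) (|w_i| / N)^(s - 1)] for finite exponents, where
    [(s - 1) r = s] puts it in the ball; a signed unit vector at a largest coordinate of [w] for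
    [p = 1]; and the sign vector of [w] for [p = +oo]. *)
Lemma hoelder_lpnorm_attained (R : realType) d (p p' : \bar R) (w : 'rV[R]_d) :
  (1 <= p)%E -> (1 <= p')%E -> inv_exp p + inv_exp p' = 1 -> w != 0 ->
  exists2 q : 'rV[R]_d, lpball p q & \sum_i w 0 i * q 0 i = lpnorm p' w.
Proof.
move=> p1 p1' pp' w0.
have sg1 (c : R) : `|Num.sg c| <= 1 by rewrite normr_sg lern1 leq_b1.
case: (conj_expP p1 p1' pp') (lpnorm_gt0 p1' w0) => [r s r1 s1 rs| |] N0.
- have r0 : 0 < r by rewrite (lt_le_trans _ r1).
  have s0 : 0 < s by rewrite (lt_trans _ s1).
  set N := lpnorm s%:E w in N0 *.
  have S1 : \sum_i (`|w 0 i| / N) `^ s = 1 by rewrite sum_normalized_powR// ltW.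
  have sr : (s - 1) * r = s.
    have : r * s * (r^-1 + s^-1) = r * s by rewrite rs mulr1.
    by rewrite mulrDr mulrAC mulfV ?gt_eqF// -mulrA mulfV ?gt_eqF//; lra.
  exists (\row_i (Num.sg (w 0 i) * (`|w 0 i| / N) `^ (s - 1))).
    apply/lpball_finE => //; rewrite -[leRHS]S1; apply: ler_sum => i _.
    rewrite mxE normrM (ger0_norm (powR_ge0 _ _)) powRM ?powR_ge0//.
    rewrite -powRrM sr -[leRHS]mul1r ler_wpM2r ?powR_ge0//.
    have := ge0_ler_powR (ltW r0) _ _ (sg1 (w 0 i)).
    by rewrite powR1; apply; rewrite nnegrE.
  rewrite -[RHS]mulr1 -[in RHS]S1 mulr_sumr; apply: eq_bigr => i _.
  rewrite mxE mulrA (mulrC (w 0 i)) -normrEsg.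
  rewrite -[in RHS](mulr_powRB1 (x := `|w 0 i| / N)) ?divr_ge0 ?(ltW N0)//.
  by rewrite mulrA mulrCA divff ?gt_eqF// mulr1.
- have [i0 _ Ni0] : exists2 i0, true & lpnorm +oo%E w = `|w 0 i0|.
    case: d w w0 N0 => [|d] w w0 N0; first by rewrite thinmx0 eqxx in w0.
    have [i0 _ Ei0] := @eq_bigmax _ R _ 0 ord0 xpredT (fun i => `|w 0 i|) erefl
      (fun i _ => normr_ge0 (w 0 i)).
    by exists i0.
  exists (\row_i (if i == i0 then Num.sg (w 0 i) else 0)).
    apply/lpball_finE => //; rewrite (bigD1 i0)//= big1 => [|i /negPf ii0].
      by rewrite mxE eqxx addr0 powRr1.
    by rewrite mxE ii0 normr0 powRr1.
  rewrite (bigD1 i0)//= big1 => [|i /negPf ii0]; last by rewrite mxE ii0 mulr0.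
  by rewrite mxE eqxx addr0 mulrC -normrEsg; exact/esym/Ni0.
- exists (\row_i Num.sg (w 0 i)).
    by apply/lpball_ooE => i; rewrite mxE.
  rewrite /= invr1 powRr1; last by apply: sumr_ge0 => i _; rewrite powR_ge0.
  by apply: eq_bigr => i _; rewrite mxE powRr1// mulrC -normrEsg.
Qed.

Lemma linfD (R : realType) d (w : 'rV[R]_d) (b : R) (x r : 'rV[R]_d) :
  linf w b (x + r) = linf w b x + \sum_i w 0 i * r 0 i.
Proof.
rewrite /linf addrAC -big_split/=; congr (_ + _).
by apply: eq_bigr => i _; rewrite mxE mulrDr.
Qed.

Lemma glab_flip_ge (R : realType) d (w : 'rV[R]_d) (b : R) (x r : 'rV[R]_d) :
  glab w b (x + r) != glab w b x ->
  `|linf w b x| <= `|\sum_i w 0 i * r 0 i|.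
Proof.
rewrite /glab linfD; set f := linf w b x; set t := \sum_i _.
case: (ltP 0 f) => f0; case: (ltP 0 (f + t)) => // ft0 _.
  by rewrite gtr0_norm// ler_normr; apply/orP; right; lra.
by rewrite ler0_norm// ler_normr; apply/orP; left; lra.
Qed.

(** The inequality is strict because boundary points carry label 0: starting from a negative value,
    reaching the boundary does not change the label. *)
Lemma glab_flip_lt (R : realType) d (w : 'rV[R]_d) (b : R) (x r : 'rV[R]_d) :
  `|linf w b x| < - Num.sg (linf w b x) * (\sum_i w 0 i * r 0 i) ->
  glab w b (x + r) != glab w b x.
Proof.
rewrite /glab linfD; set f := linf w b x; set t := \sum_i _.
case: (ltgtP 0 f) => f0.
- rewrite gtr0_norm// gtr0_sg// mulN1r => h.
  by have -> : (0 < f + t) = false by apply/negbTE; rewrite -leNgt; lra.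
- rewrite ltr0_norm// ltr0_sg// opprK mul1r => h.
  by have -> : (0 < f + t) by lra.
- by rewrite -f0 sgr0 normr0 oppr0 mul0r ltxx.
Qed.

Lemma rstar_normE (R : realType) d (p p' : \bar R) (w : 'rV[R]_d) (b : R)
    (x : 'rV[R]_d) :
  (1 <= p)%E -> (1 <= p')%E -> inv_exp p + inv_exp p' = 1 ->
  w != 0 -> linf w b x != 0 ->
  rstar_norm p w b x = `|linf w b x| / lpnorm p' w.
Proof.
move=> p1 p1' pp' w0 f0; set N := lpnorm p' w; set f := linf w b x.
have N0 : 0 < N by exact: lpnorm_gt0.
have [q qB wq] := hoelder_lpnorm_attained p1 p1' pp' w0.
(* A multiple of the extremal vector that overshoots the boundary by the relative amount [e], since
   the infimum need not be attained. *)
pose r (e : R) := (- Num.sg f * ((1 + e) * (`|f| / N))) *: q.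
have wr e : \sum_i w 0 i * r e 0 i = - Num.sg f * ((1 + e) * `|f|).
  under eq_bigr => i _ do rewrite mxE mulrCA.
  by rewrite -mulr_sumr wq -/N; field; rewrite gt_eqF.
have flip e : 0 < e -> glab w b (x + r e) != glab w b x.
  move=> e0; apply: glab_flip_lt; rewrite wr -/f mulrA mulrNN -expr2.
  by rewrite sqr_sg f0 mul1r ltr_pMl ?normr_gt0// ltrDl.
have lb : lbound
    [set lpnorm p r | r in [set r | glab w b (x + r) != glab w b x]] (`|f| / N).
  move=> _ [t /= tflip <-]; rewrite ler_pdivrMr// mulrC.
  by apply: le_trans (glab_flip_ge tflip) _; exact: hoelder_lpnorm.
apply/eqP; rewrite eq_le; apply/andP; split; last first.
  by apply: lb_le_inf lb; exists (lpnorm p (r 1)), (r 1) => //; exact: flip.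
apply/ler_addgt0Pr => e e0.
have F0 : 0 < `|f| / N by rewrite divr_gt0 ?normr_gt0.
have h0 : 0 < e / (`|f| / N) by rewrite divr_gt0.
(* This relative overshoot adds exactly [e] to the bound on the norm. *)
apply: (@le_trans _ _ (lpnorm p (r (e / (`|f| / N))))).
  apply: ge_inf; first by exists (`|f| / N).
  by exists (r (e / (`|f| / N))) => //; exact: flip.
apply: le_trans (lpnormZ_le _ _ p1) _.
rewrite normrM normrN normr_sg f0 mul1r ger0_norm; last first.
  by rewrite mulr_ge0 ?(ltW F0)// addr_ge0// ltW.
apply: le_trans (ler_piMr _ qB) _.
  by rewrite mulr_ge0 ?(ltW F0)// addr_ge0// ltW.
by rewrite mulrDl mul1r mulfVK ?gt_eqF.
Qed.

(** * Flip probabilities *)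

Lemma lpnorm2E (R : realType) d (w : 'rV[R]_d) :
  lpnorm 2%:E w = Num.sqrt (\sum_i w 0 i ^+ 2).
Proof.
rewrite /lpnorm powR12_sqrt; last by apply: sumr_ge0 => i _; exact: powR_ge0.
congr Num.sqrt; apply: eq_bigr => i _.
by rewrite powR_mulrn// real_normK ?num_real.
Qed.

Section flip_probability.
Context {R : realType} {d : nat} {p : \bar R}.
Hypothesis p1 : (1 <= p)%E.
Variables (w : 'rV[R]_d.+1) (b : R) (x : 'rV[R]_d.+1).
Let D : R := d.+1%:R `^ inv_exp p.
Let f : R := linf w b x.
Let W : R := \sum_i w 0 i ^+ 2.
Let V : R := fine (leb_outer (@lpball R d.+1 p)).
Hypothesis f0 : f != 0.

Let D_gt0 : 0 < D. Proof. by rewrite powR_gt0// ltr0n. Qed.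

Let V_gt0 : 0 < V.
Proof.
rewrite fine_gt0// leb_outer_lpball_gt0//.
by rewrite ltey_eq leb_outer_lpball_fin_num.
Qed.

Let linear_scale alpha (v : 'rV[R]_d.+1) :
  \sum_i w 0 i * (alpha *: v) 0 i = alpha * \sum_i w 0 i * v 0 i.
Proof. by rewrite mulr_sumr; apply: eq_bigr => i _; rewrite mxE mulrCA. Qed.

(** A flip forces [|alpha| |w.v| >= |f|], that is [|D w.v| >= t] with [t = D |f| / |alpha|], and the
    Chebyshev bound applies. At [alpha = 0] no point flips. *)
Lemma flip_prob_le alpha :
  flip_prob p w b x alpha * (D * `|f|) ^+ 2 <= (1 + moment4 R) * W * alpha ^+ 2.
Proof.
have [->|a0] := eqVneq alpha 0.
  rewrite /flip_prob (_ : _ `&` _ = set0); last first.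
    rewrite -subset0 => v [_ /= /glab_flip_ge].
    by rewrite linear_scale mul0r normr0 normr_le0 (negPf f0).
  by rewrite leb_outer_set0 !mul0r expr0n mulr0.
have {}a0 : 0 < `|alpha| by rewrite normr_gt0.
pose t := D * `|f| / `|alpha|.
have t0 : 0 < t by rewrite divr_gt0// mulr_gt0// normr_gt0.
have := lpball_linear_tail p1 w t0; rewrite -/V -/W => tail.
have sub : fine (leb_outer (lpball p `&`
      [set v | glab w b (x + alpha *: v) != glab w b x])) <=
    fine (leb_outer (lpball p `&`
      [set z : 'rV[R]_d.+1 | t <= `|D * \sum_i w 0 i * z 0 i|])).
  apply: (fine_le_leb_outer_lpball p1) => [v [vB /= fl]|v []//]; split => //=.
  have := glab_flip_ge fl; rewrite linear_scale -/f normrM => fa.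
  by rewrite /t ler_pdivrMr// normrM (gtr0_norm D_gt0) -mulrA ler_pM2l// mulrC.
have {}sub := le_trans (ler_wpM2l (sqr_ge0 t) sub) tail.
rewrite -/D in sub.
rewrite /flip_prob -/V.
set m := fine (leb_outer (_ `&` _)) in sub *.
rewrite -(real_normK (num_real alpha)).
have a2 : 0 < `|alpha| ^+ 2 by rewrite exprn_gt0.
rewrite -ler_pdivrMr//.
have -> : m / V * (D * `|f|) ^+ 2 / `|alpha| ^+ 2 = t ^+ 2 * m / V.
  by rewrite /t; field; rewrite !gt_eqF.
by rewrite ler_pdivrMr// (mulrAC _ W V).
Qed.

(** The sign of [alpha] is opposite to that of [f], and its size makes every [v] with
    [D w.v > sqrt (moment2 / 4 * W)] flip the label; anticoncentration bounds the measure of these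
    [v]. *)
Lemma flip_prob_ge : 0 < W ->
  moment2 R ^+ 2 / (36 * moment4 R) <=
  flip_prob p w b x (- Num.sg f * (`|f| * D / Num.sqrt (moment2 R / 4 * W))).
Proof.
move=> W0; rewrite /flip_prob ler_pdivlMr//.
apply: le_trans (lpball_linear_anticoncentration p1 W0) _.
apply: (fine_le_leb_outer_lpball p1) => [v [vB /= cv]|v []//]; split => //=.
have s0 : 0 < Num.sqrt (moment2 R / 4 * W).
  by rewrite sqrtr_gt0 mulr_gt0// divr_gt0// moment2_gt0.
move: cv s0; set s := Num.sqrt _; set t := \sum_i _ => cv s0.
apply: glab_flip_lt; rewrite linear_scale -/f -/t mulrA mulrA mulrNN -expr2.
rewrite sqr_sg f0 mul1r.
rewrite (_ : _ / s * t = `|f| * (D * t / s)); last by ring.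
by rewrite ltr_pMr ?normr_gt0// ltr_pdivlMr// mul1r.
Qed.

End flip_probability.

(** * The two-sided bound on the ratio *)

Theorem theorem1 (R : realType) :
  exists C c c' : R, [/\ 0 < C, 0 < c & 0 < c'] /\
  forall (d : nat) (p p' : \bar R) (w : 'rV[R]_d) (b : R) (x : 'rV[R]_d) (eps : R),
    (1 <= d)%N ->
    (1 <= p)%E -> (1 <= p')%E -> inv_exp p + inv_exp p' = 1 ->
    w != 0 -> linf w b x != 0 ->
    0 < eps -> eps < c ^+ 2 / c' ->
    let K := (d%:R) `^ (inv_exp p) * lpnorm p' w / lpnorm 2%:E w in
    let ratio := (r_peps p w b x eps * ((rstar_norm p w b x)^-1)%:E)%E in
    ((C * Num.sqrt eps * K)%:E <= ratio)%E /\
    (ratio <= ((Num.sqrt (c - Num.sqrt (c' * eps)))^-1 * K)%:E)%E.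
Proof.
move: (moment2_gt0 R) (moment4_gt0 R) (@flip_prob_le R) (@flip_prob_ge R).
move: (moment2 R) (moment4 R) => a M a0 M0 prob_le prob_ge.
pose c := a / 4; have c0 : 0 < c by rewrite divr_gt0.
pose e0 := a ^+ 2 / (36 * M).
have e0_gt0 : 0 < e0 by rewrite divr_gt0 ?exprn_gt0// mulr_gt0.
(* The range of [eps] is so short that only [1 / sqrt c] matters in the upper
   bound. *)
pose c' := c ^+ 2 / e0; have c'0 : 0 < c' by rewrite divr_gt0// exprn_gt0.
have M1 : 0 < 1 + M by rewrite addr_gt0.
exists (Num.sqrt (1 + M))^-1, c, c'; split.
  by split => //; rewrite invr_gt0 sqrtr_gt0.
case=> // d p p' w b x eps _ p1 p1' pp' w0 f0 eps0.
have -> : c ^+ 2 / c' = e0 by rewrite /c'; field; rewrite !gt_eqF.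
move=> epse0 K ratio.
set f := linf w b x in f0; set N := lpnorm p' w.
have N0 : 0 < N by exact: lpnorm_gt0.
have nf0 : 0 < `|f| by rewrite normr_gt0.
pose W := \sum_i w 0 i ^+ 2.
have sW0 : 0 < Num.sqrt W by rewrite -lpnorm2E lpnorm_gt0// lee_fin ler1n.
have W0 : 0 < W by rewrite -sqrtr_gt0.
pose D := d.+1%:R `^ inv_exp p.
have D0 : 0 < D by rewrite powR_gt0// ltr0n.
have KE : K = D * N / Num.sqrt W by rewrite /K lpnorm2E.
have rE : rstar_norm p w b x = `|f| / N by exact: rstar_normE.
have r0 : 0 < `|f| / N by rewrite divr_gt0.
rewrite /ratio rE; split.
- rewrite lee_pdivlMr// -EFinM; apply: le_ereal_inf_tmp => _ [alpha /= ea <-].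
  rewrite lee_fin.
  have := prob_le d p p1 w b x f0 alpha; rewrite -/f -/D -/W => fp.
  (* The square root of this inequality bounds [|alpha|] from below for every admissible [alpha],
     with the factor [1 / sqrt (1 + M)] chosen as the lower constant. *)
  have {fp} : eps * (D * `|f|) ^+ 2 <= (1 + M) * W * alpha ^+ 2.
    by apply: le_trans fp; rewrite ler_wpM2r ?sqr_ge0.
  rewrite -ler_sqrt; last first.
    by rewrite mulr_ge0 ?sqr_ge0// mulr_ge0// ltW.
  rewrite (sqrtrM _ (ltW eps0)) (sqrtrM _ (ltW (mulr_gt0 M1 W0))).
  rewrite (sqrtrM _ (ltW M1)) !sqrtr_sqr.
  rewrite (gtr0_norm (mulr_gt0 D0 nf0)) => h.
  have sM0 : 0 < Num.sqrt (1 + M) by rewrite sqrtr_gt0.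
  have -> : (Num.sqrt (1 + M))^-1 * Num.sqrt eps * K * (`|f| / N) =
      Num.sqrt eps * (D * `|f|) / (Num.sqrt (1 + M) * Num.sqrt W).
    by rewrite KE; field; rewrite !gt_eqF.
  by rewrite ler_pdivrMr ?mulr_gt0// [leRHS]mulrC.
- have sc0 : 0 < Num.sqrt c by rewrite sqrtr_gt0.
  (* The size of the [alpha] of [prob_ge]; it is admissible because its flip probability is at least
     [e0 > eps]. *)
  pose beta := `|f| * D / (Num.sqrt c * Num.sqrt W).
  have beta0 : 0 < beta by rewrite divr_gt0 ?mulr_gt0.
  have rb : (r_peps p w b x eps <= beta%:E)%E.
    apply: ereal_inf_lbound; exists (- Num.sg f * beta).
      have := prob_ge d p p1 w b x f0 W0; rewrite -/e0 -/W -/c -/D -/f.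
      by rewrite sqrtrM ?(ltW c0)//; apply: le_trans; exact: ltW.
    by rewrite normrM normrN normr_sg f0 mul1r gtr0_norm.
  apply: (@le_trans _ _ (beta%:E * (`|f| / N)^-1%:E)%E).
    by apply: lee_wpmul2r rb; rewrite lee_fin invr_ge0 ltW.
  rewrite -EFinM lee_fin.
  have -> : beta / (`|f| / N) = (Num.sqrt c)^-1 * K.
    by rewrite KE /beta; field; rewrite !gt_eqF.
  have K0 : 0 <= K by rewrite KE divr_ge0 ?mulr_ge0// ltW.
  apply: ler_wpM2r => //.
  (* Since [c' * e0 = c ^+ 2], the condition [eps < e0] keeps [c - sqrt (c' * eps)] positive; being
     at most [c], it only weakens the bound [1 / sqrt c]. *)
  have small : Num.sqrt (c' * eps) < c.
    rewrite -[ltRHS](gtr0_norm c0) -sqrtr_sqr ltr_sqrt ?exprn_gt0//.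
    rewrite /c' mulrAC -mulrA gtr_pMr ?exprn_gt0//.
    by rewrite ltr_pdivrMr// mul1r.
  rewrite lef_pV2 ?posrE ?sqrtr_gt0 ?subr_gt0// ler_sqrt ?(ltW c0)//.
  by rewrite lerBlDr lerDl sqrtr_ge0.
Qed.
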